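(* Let $m,n\ge 2$ and let $A=(U(m,n-1),I)$. Then there are irreducible morphisms $h_i:X_i\to X_{i+1}$, $1\le i\le n$, between indecomposable $A$-modules such that $h_n\cdots h_1\in \Re^{n+2m}(X_1,X_{n+1})\setminus \Re^{n+2m+1}(X_1,X_{n+1})$, $h_{n-1}\cdots h_1\notin \Re^{n}(X_1,X_n)$ and $h_n\cdots h_2\notin \Re^{n}(X_2,X_{n+1})$.
   Context: Let $k$ be a field. For $m,n\ge 2$, $(U(m,n-1),I)$ denotes the bound quiver algebra $kQ/I$, where $Q$ consists of two parallel paths from a vertex $1$ to a vertex $x$: the path $1\xrightarrow{\gamma_1}a_2\xrightarrow{\gamma_2}\cdots\xrightarrow{\gamma_{m-1}}a_m\xrightarrow{\gamma_m}x$ with $m$ arrows, and the path $1\xrightarrow{\beta_1}b_2\xrightarrow{\beta_2}\cdots\xrightarrow{\beta_{n-2}}b_{n-1}\xrightarrow{\beta_{n-1}}x$ with $n-1$ arrows (the vertices $1,a_2,\dots,a_m,b_2,\dots,b_{n-1},x$ being distinct), and $I=\langle \gamma_{m-1}\gamma_m\rangle$, where $\gamma_{m-1}\gamma_m$ is the path $\gamma_{m-1}$ followed by $\gamma_m$. Modules are finite-dimensional and are identified with representations of the bound quiver, so that the indecomposable projective at a vertex $u$ has a basis given by the nonzero paths starting at $u$. A morphism $f:X\to Y$ is irreducible if it does not split and whenever $f=gh$, either $h$ is a split monomorphism or $g$ is a split epimorphism. $\Re(X,Y)$ is the set of morphisms $f:X\to Y$ such that for every indecomposable $M$ and all $h:M\to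 X$, $h':Y\to M$ the composition $h'fh$ is not an isomorphism, and $\Re^n(X,Y)$ denotes the $n$-th power of this ideal, i.e. the finite sums of compositions of $n$ radical morphisms. *)

(* Defs.v *)
From HB Require Import structures.
From mathcomp Require Import all_boot all_order all_algebra.

Set Implicit Arguments.
Unset Strict Implicit.
Unset Printing Implicit Defensive.

Import GRing.Theory.
Local Open Scope ring_scope.

Record quiver := Quiver {
  vertex : finType;
  arrow : finType;
  src : arrow -> vertex;
  tgt : arrow -> vertex
}.

(* Paths are read from left to right: [qcons a p] is a followed by p. *)
Inductive qpath (Q : quiver) : vertex Q -> vertex Q -> Type :=
| qnil v : qpath v v
| qcons (a : arrow Q) w : qpath (tgt a) w -> qpath (src a) w.

Arguments qnil {Q} v.
Arguments qcons {Q} a {w} p.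

(* A quiver together with a set of paths generating the ideal of relations
   (only monomial ideals are needed). *)
Record bound_quiver := BoundQuiver {
  bq_quiver :> quiver;
  bq_rel : forall u v : vertex bq_quiver, qpath u v -> Prop
}.

Fixpoint path_map (k : fieldType) (Q : quiver) (V : vertex Q -> vectType k)
    (F : forall a : arrow Q, 'Hom(V (src a), V (tgt a)))
    (u v : vertex Q) (p : qpath u v) : 'Hom(V u, V v) :=
  match p in qpath u v return 'Hom(V u, V v) with
  | qnil v => \1%VF
  | qcons a w p => (path_map F p \o F a)%VF
  end.

(* Finite-dimensional representations; the maps vanish on the ideal of
   relations as soon as they vanish on its generators.  Representations are
   covariant, so that the nonzero paths starting at u form a basis of the
   projective at u. *)
Record rep (k : fieldType) (B : bound_quiver) := Rep {
  rep_space :> vertex B -> vectType k;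
  rep_map : forall a : arrow B, 'Hom(rep_space (src a), rep_space (tgt a));
  rep_bound : forall (u v : vertex B) (p : qpath u v),
    bq_rel p -> path_map rep_map p = 0
}.

Section Representations.
Variables (k : fieldType) (B : bound_quiver).
Implicit Types M X Y Z : rep k B.

Record rep_hom X Y := RepHom {
  hom_map :> forall v : vertex B, 'Hom(X v, Y v);
  hom_comm : forall a : arrow B,
    (hom_map (tgt a) \o rep_map X a = rep_map Y a \o hom_map (src a))%VF
}.

(* Equality of morphisms, stated pointwise to avoid functional
   extensionality. *)
Definition hom_eq X Y (f g : rep_hom X Y) : Prop := forall v, f v = g v.

Lemma hom_id_comm X (a : arrow B) :
  (\1 \o rep_map X a = rep_map X a \o \1)%VF.
Proof. by rewrite comp_lfun1l comp_lfun1r. Qed.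

Definition hom_id X : rep_hom X X :=
  @RepHom X X (fun v => \1%VF) (hom_id_comm X).

Lemma hom_comp_comm X Y Z (g : rep_hom Y Z) (f : rep_hom X Y) (a : arrow B) :
  ((g (tgt a) \o f (tgt a)) \o rep_map X a =
   rep_map Z a \o (g (src a) \o f (src a)))%VF.
Proof. by rewrite -comp_lfunA hom_comm !comp_lfunA hom_comm. Qed.

Definition hom_comp X Y Z (g : rep_hom Y Z) (f : rep_hom X Y) : rep_hom X Z :=
  @RepHom X Z (fun v => (g v \o f v)%VF) (hom_comp_comm g f).

Definition split_mono X Y (f : rep_hom X Y) : Prop :=
  exists g : rep_hom Y X, hom_eq (hom_comp g f) (hom_id X).

Definition split_epi X Y (f : rep_hom X Y) : Prop :=
  exists g : rep_hom Y X, hom_eq (hom_comp f g) (hom_id Y).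

Definition is_iso X Y (f : rep_hom X Y) : Prop :=
  exists g : rep_hom Y X,
    hom_eq (hom_comp g f) (hom_id X) /\ hom_eq (hom_comp f g) (hom_id Y).

Definition is_subrep M (U : forall v, {vspace M v}) : Prop :=
  forall a : arrow B, (rep_map M a @: U (src a) <= U (tgt a))%VS.

(* Nonzero, and not the internal direct sum of two nonzero
   subrepresentations. *)
Definition indecomposable M : Prop :=
  (exists v, {: M v}%VS != 0%VS) /\
  forall U W : forall v, {vspace M v},
    is_subrep U -> is_subrep W ->
    (forall v, (U v + W v = fullv)%VS /\ (U v :&: W v = 0)%VS) ->
    (forall v, U v = 0%VS) \/ (forall v, W v = 0%VS).

Definition irreducible X Y (f : rep_hom X Y) : Prop :=
  [/\ ~ split_mono f, ~ split_epi f &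
      forall Z (h : rep_hom X Z) (g : rep_hom Z Y),
        hom_eq f (hom_comp g h) -> split_mono h \/ split_epi g].

Definition radical X Y (f : rep_hom X Y) : Prop :=
  forall M (h : rep_hom M X) (h' : rep_hom Y M),
    indecomposable M -> ~ is_iso (hom_comp h' (hom_comp f h)).

(* Compositions of n radical morphisms; for n = 0 any morphism, since the
   zeroth power of the radical is the whole Hom bifunctor. *)
Fixpoint rad_comp (n : nat) X Y (f : rep_hom X Y) : Prop :=
  match n with
  | 0 => True
  | 1 => radical f
  | p.+1 => exists Z (h : rep_hom X Z) (g : rep_hom Z Y),
      [/\ radical h, rad_comp p g & hom_eq f (hom_comp g h)]
  end.

Definition rad_pow (n : nat) X Y (f : rep_hom X Y) : Prop :=
  exists (r : nat) (g : 'I_r -> rep_hom X Y),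
    (forall i, rad_comp n (g i)) /\ forall v, f v = \sum_(i < r) g i v.

(* h_(i+l-1) ... h_(i+1) h_i, a composition of l morphisms. *)
Fixpoint hom_chain (X : nat -> rep k B) (h : forall i, rep_hom (X i) (X i.+1))
    (i l : nat) : rep_hom (X i) (X (l + i)%N) :=
  match l return rep_hom (X i) (X (l + i)%N) with
  | 0 => hom_id (X i)
  | l'.+1 => hom_comp (h (l' + i)%N) (hom_chain h i l')
  end.

End Representations.

(* The bound quiver (U(m, r), I): parallel paths of length m and r from 1 to x.
   [Ua j] is a_(j+2) and [Ub j] is b_(j+2). *)
Section U.
Variables m r : nat.

Inductive U_vertex := U1 | Ua of 'I_m.-1 | Ub of 'I_r.-1 | Ux.

Definition U_vertex_code (v : U_vertex) : bool + ('I_m.-1 + 'I_r.-1) :=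
  match v with
  | U1 => inl true
  | Ux => inl false
  | Ua j => inr (inl j)
  | Ub j => inr (inr j)
  end.

Definition U_vertex_decode (c : bool + ('I_m.-1 + 'I_r.-1)) : U_vertex :=
  match c with
  | inl b => if b then U1 else Ux
  | inr (inl j) => Ua j
  | inr (inr j) => Ub j
  end.

Lemma U_vertex_codeK : cancel U_vertex_code U_vertex_decode.
Proof. by case. Qed.

HB.instance Definition _ := Finite.copy U_vertex (can_type U_vertex_codeK).

(* The i-th vertex, counted from 0, of the gamma (resp. beta) path: 1 for
   i = 0, and x for i = m (resp. i = r). *)
Definition gamma_vertex (i : nat) : U_vertex :=
  if i is i'.+1 then (if insub i' is Some j then Ua j else Ux) else U1.

Definition beta_vertex (i : nat) : U_vertex :=
  if i is i'.+1 then (if insub i' is Some j then Ub j else Ux) else U1.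

(* [inl i] is gamma_(i+1) and [inr i] is beta_(i+1). *)
Definition U_src (a : 'I_m + 'I_r) : U_vertex :=
  match a with inl i => gamma_vertex i | inr i => beta_vertex i end.

Definition U_tgt (a : 'I_m + 'I_r) : U_vertex :=
  match a with inl i => gamma_vertex i.+1 | inr i => beta_vertex i.+1 end.

Definition U_quiver : quiver := Quiver U_src U_tgt.

(* The path gamma_(i+1) gamma_(i+2). *)
Definition gamma_gamma (i : nat) (lt0 : (i < m)%N) (lt1 : (i.+1 < m)%N) :
    @qpath U_quiver (gamma_vertex i) (gamma_vertex i.+2) :=
  @qcons U_quiver (inl (Ordinal lt0)) _
    (@qcons U_quiver (inl (Ordinal lt1)) _ (qnil _)).

Inductive U_rel : forall u v : vertex U_quiver, qpath u v -> Prop :=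
| U_rel_gamma i (lt0 : (i < m)%N) (lt1 : (i.+1 < m)%N) :
    i.+2 = m -> U_rel (gamma_gamma lt0 lt1).

Definition U_bound : bound_quiver := BoundQuiver U_rel.

End U.

(* Main.v *)
Require Import Defs.
From HB Require Import structures.
From mathcomp Require Import all_boot all_order all_algebra.
From mathcomp Require Import zify.
From Stdlib Require Import Classical.

Set Implicit Arguments.
Unset Strict Implicit.
Unset Printing Implicit Defensive.

Import GRing.Theory.
Local Open Scope ring_scope.

(** Let [N = m + n]. The longest walk in the quiver that avoids the relation has
    [N] positions: it starts at [a_m], runs through [x], up the beta path to the
    vertex 1 and down the gamma path to [a_m] again. Every interval [[i, j]] of
    positions yields a string module, with one basis vector for each position, and
    the only vertex met twice is [a_m], at the positions 0 and [N - 1]. The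
    indecomposable modules are those of a linear quiver with [N] vertices, except
    that the simple modules at its two ends become the same module [S] at [a_m]. A morphism that factors
    through [S] first travels to the end of the linear quiver and then starts again
    at its beginning, which makes it very deep in the radical.

    The chain consists of the inclusion of [[0, n - 1]] into [[0, N - 1]], followed by
    the projections to [[2, N - 1]], [[3, N - 1]], .., [[n, N - 1]]. The composition of
    these [n] morphisms is zero. Adding to the inclusion the morphism through [S]
    that sends the basis vector at 0 to the one at [N - 1] changes it only in a deep
    power of the radical, and the new composition is the passage from [[0, n - 1]]
    to [[n, N - 1]] through [S]. It factors into [n + 2 m] radical morphisms
    between string modules ([chain_deep]): [m + 1] of them lead to [S] and the other
    [n + m - 1] lead from [S] to the end.

    For the upper bounds on the depth, fix a position [p] of a string [[i, j]]. The
    vectors of a module [M] at the vertex of [p] which are images of the basis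
    vector under a morphism from the string module form a subspace, computed by
    following linear relations from both ends of the string. Morphisms from [M] to
    the string module are governed by the same recursion with different conditions
    at the ends. If a morphism sends a vector that comes from the string module to
    one that can be mapped back to the basis vector, then the string module is a
    direct summand on both sides and the morphism is not radical. Hence a radical
    morphism sends the first subspace into the smaller one that the functionals
    cut out ([radical_shift]), and this smaller subspace is contained in the one that
    belongs to the next string.

    At [a_m] the strings are linearly ordered, and from [[0, n - 1]] on there are
    [n + 2 m + 1] of them; after as many radical morphisms nothing is left
    ([reached_shift]). This bounds the depth of the whole composition
    ([chain_not_deeper]) and of its last [n - 1] factors ([chain_tail_shallow]). The
    first [n - 1] factors are tested at position [n - 1] instead, where the
    strings form a two-dimensional grid and the modular law is needed ([grid_shift],
    [chain_init_shallow]). Irreducibility is a consequence: a radical morphism between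
    indecomposable modules is irreducible unless it lies in the square of the
    radical, and then one of the two compositions of [n - 1] factors would lie in the
    [n]-th power. *)

(** * The radical and indecomposable representations *)

Section Radical.
Variables (k : fieldType) (B : bound_quiver).
Implicit Types M X Y Z : rep k B.

Lemma hom_natural X Y (f : rep_hom X Y) (a : arrow B) x :
  f (tgt a) (rep_map X a x) = rep_map Y a (f (src a) x).
Proof. by have /lfunP/(_ x) := hom_comm f a; rewrite !comp_lfunE. Qed.

Lemma hom_compE X Y Z (g : rep_hom Y Z) (f : rep_hom X Y) v x :
  hom_comp g f v x = g v (f v x).
Proof. exact: comp_lfunE. Qed.

Lemma indecomposable_neq0 X : indecomposable X -> exists v, exists x : X v, x != 0.
Proof.
move=> [[v nz] _]; exists v; exists (vpick {: X v}%VS).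
by rewrite vpick0.
Qed.

(** For a retraction [r] of [s], [limg s] and [lker r] are complementary
    subrepresentations of the middle term. *)
Lemma retraction_section M X (s : rep_hom M X) (r : rep_hom X M) :
  indecomposable X -> (exists v, exists x : M v, x != 0) ->
  hom_eq (hom_comp r s) (hom_id M) -> hom_eq (hom_comp s r) (hom_id X).
Proof.
move=> [_ indX] [v0 [x0 nzx0]] rs1.
have rsK v x : r v (s v x) = x.
  by rewrite -hom_compE (rs1 v) id_lfunE.
have subU : is_subrep (fun v => limg (s v)).
  move=> a; apply/subvP=> _ /memv_imgP[_ /memv_imgP[x _ ->] ->].
  by rewrite -hom_natural memv_img ?memvf.
have subW : is_subrep (fun v => lker (r v)).
  move=> a; apply/subvP=> y /memv_imgP[x]; rewrite memv_ker => /eqP rx0 ->.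
  by rewrite memv_ker hom_natural rx0 linear0.
have direct v : (limg (s v) + lker (r v) = fullv)%VS /\
                (limg (s v) :&: lker (r v) = 0)%VS.
  split.
    apply/vspaceP=> x; rewrite memvf -[x](subrK (s v (r v x))) addrC.
    by apply: memv_add; rewrite ?memv_img ?memvf // memv_ker linearB /= rsK subrr.
  apply/eqP; rewrite -subv0; apply/subvP=> x /memv_capP[/memv_imgP[y _ ->]].
  by rewrite memv_ker rsK => /eqP->; rewrite linear0 mem0v.
case: (indX _ _ subU subW direct) => [U0 | W0] v.
  have : s v0 x0 \in limg (s v0) by rewrite memv_img ?memvf.
  by rewrite U0 memv0 => /eqP sx0; rewrite -(rsK _ x0) sx0 linear0 eqxx in nzx0.
apply/lfunP=> x; rewrite hom_compE id_lfunE; apply/eqP.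
by rewrite -subr_eq0 -memv0 -(W0 v) memv_ker linearB /= rsK subrr.
Qed.

Lemma subrep_projection M (S T : forall v, {vspace M v}) :
  is_subrep S -> is_subrep T ->
  (forall v, (S v + T v = fullv)%VS /\ (S v :&: T v = 0)%VS) ->
  exists pi : rep_hom M M,
    forall v, {in S v, forall x, pi v x = x} /\ {in T v, forall x, pi v x = 0}.
Proof.
move=> subS subT direct; pose pi v := daddv_pi (S v) (T v).
have piS v : {in S v, forall x, pi v x = x}.
  by move=> x Sx; rewrite /pi daddv_pi_id // (direct v).2.
have piT v : {in T v, forall x, pi v x = 0}.
  move=> x Tx; have := daddv_pi_add (direct v).2 (subvP (addvSr (S v) _) x Tx).
  have TS0 : (T v :&: S v = 0)%VS by rewrite capvC (direct v).2.
  rewrite [daddv_pi (T v) _ x]daddv_pi_id // => /(canRL (addrK _)).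
  by rewrite subrr.
have pi_comm (a : arrow B) : (pi (tgt a) \o rep_map M a = rep_map M a \o pi (src a))%VF.
  apply/lfunP=> x; rewrite !comp_lfunE.
  have /memv_addP[y Sy [z Tz ->]] : x \in (S (src a) + T (src a))%VS.
    by rewrite (direct _).1 memvf.
  rewrite !linearD /= (piS _ y) // (piT _ z) // linear0.
  by rewrite piS ?piT // ?(subvP (subS a)) ?(subvP (subT a)) ?memv_img.
by exists (RepHom pi_comm).
Qed.

(** If one matrix coefficient of an endomorphism decides its injectivity,
    then one of two complementary projections is injective, because their
    coefficients add up to a nonzero scalar. *)
Lemma indecomposable_of_coef M v0 (e : M v0) (phi : 'Hom(M v0, k^o)) :
  phi e != 0 ->
  (forall psi : rep_hom M M, phi (psi v0 e) != 0 -> forall v, lker (psi v) == 0%VS) ->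
  indecomposable M.
Proof.
move=> nz inj; split.
  exists v0; apply: contraNneq nz => full0.
  by have := memvf e; rewrite full0 memv0 => /eqP->; rewrite linear0.
move=> S T subS subT direct.
have [pi piP] := subrep_projection subS subT direct.
have direct' v : (T v + S v = fullv)%VS /\ (T v :&: S v = 0)%VS.
  by rewrite addvC [in X in _ /\ X]capvC.
have [pi' piP'] := subrep_projection subT subS direct'.
have sum1 : phi (pi v0 e) + phi (pi' v0 e) = phi e.
  have /memv_addP[y Sy [z Tz ->]] : e \in (S v0 + T v0)%VS by rewrite (direct _).1 memvf.
  have [[piS piT] [piT' piS']] := (piP v0, piP' v0).
  by rewrite !linearD /= (piS y) // (piT z) // (piT' z) // (piS' y) // !linear0 addr0 add0r.
have [pi0|pi_nz] := eqVneq (phi (pi v0 e)) 0; [left|right] => v; apply/eqP;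
    rewrite -subv0; apply/subvP=> x; rewrite memv0 => memx.
  have nz' : phi (pi' v0 e) != 0 by move: nz; rewrite -sum1 pi0 add0r.
  have /lker0P injv := inj _ nz' v.
  by apply/eqP/injv; rewrite linear0 (piP' v).2.
have /lker0P injv := inj _ pi_nz v.
by apply/eqP/injv; rewrite linear0 (piP v).2.
Qed.

(** An invertible [h' f h] splits [h]; as [X] is indecomposable, [h] is then an
    isomorphism, and so [f] is split as well. *)
Lemma radical_of_not_split_mono X Y (f : rep_hom X Y) :
  indecomposable X -> ~ split_mono f -> radical f.
Proof.
move=> indX nsm M h h' indM [g [gK _]]; apply: nsm.
have retr : hom_eq (hom_comp (hom_comp g (hom_comp h' f)) h) (hom_id M).
  by move=> v; apply/lfunP=> x; rewrite -gK !hom_compE.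
have sect := retraction_section indX (indecomposable_neq0 indM) retr.
exists (hom_comp h (hom_comp g h')) => v; apply/lfunP=> x.
by rewrite -sect !hom_compE.
Qed.

Lemma radical_of_not_split_epi X Y (f : rep_hom X Y) :
  indecomposable Y -> ~ split_epi f -> radical f.
Proof.
move=> indY nse M h h' indM [g [gK _]]; apply: nse.
have retr : hom_eq (hom_comp (hom_comp g h') (hom_comp f h)) (hom_id M).
  by move=> v; apply/lfunP=> x; rewrite -gK !hom_compE.
have sect := retraction_section indY (indecomposable_neq0 indM) retr.
exists (hom_comp h (hom_comp g h')) => v; apply/lfunP=> x.
by rewrite -sect !hom_compE.
Qed.

(** An endomorphism that is injective at every vertex is invertible, by
    finiteness of the dimensions, and the inverse maps form a morphism. *)
Lemma radical_not_injective X Y (f : rep_hom X Y) M (h : rep_hom M X) (h' : rep_hom Y M) :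
  radical f -> indecomposable M ->
  ~ (forall v, lker (hom_comp h' (hom_comp f h) v) == 0%VS).
Proof.
set p := hom_comp h' _ => radf indM inj; apply: (radf M h h' indM).
have inv_comm (a : arrow B) :
    ((p (tgt a))^-1 \o rep_map M a = rep_map M a \o (p (src a))^-1)%VF.
  apply/lfunP=> x; rewrite !comp_lfunE.
  have /lker0P := inj (tgt a); apply.
  by rewrite hom_natural !lker0_lfunVK.
exists (@RepHom _ _ M M (fun v => (p v)^-1%VF) inv_comm).
by split=> v; rewrite /= ?lker0_compVf ?lker0_compfV.
Qed.

(** In a factorization of [f] without split factors both factors are radical,
    because the outer modules are indecomposable; so [f] would be in the square
    of the radical. *)
Lemma radical_irreducible X Y (f : rep_hom X Y) :
  indecomposable X -> indecomposable Y -> radical f -> ~ rad_comp 2 f ->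
  irreducible f.
Proof.
move=> indX indY radf nrad2; split.
- move=> [g gf1]; apply: (radf X (hom_id X) g indX); exists (hom_id X).
  by split=> v; apply/lfunP=> x; rewrite !hom_compE !id_lfunE -hom_compE gf1 id_lfunE.
- move=> [g fg1]; apply: (radf Y g (hom_id Y) indY); exists (hom_id Y).
  by split=> v; apply/lfunP=> x; rewrite !hom_compE !id_lfunE -hom_compE fg1 id_lfunE.
move=> Z h g fgh; apply: NNPP => /not_or_and[nsm nse]; apply: nrad2.
exists Z, h, g; split=> //; last exact: radical_of_not_split_epi.
exact: radical_of_not_split_mono.
Qed.

Lemma rad_comp_eq d X Y (f g : rep_hom X Y) :
  hom_eq f g -> rad_comp d f -> rad_comp d g.
Proof.
move=> fg; case: d => [|[|d]] //.
  move=> radf M h h' indM [u [uK Ku]]; apply: (radf M h h' indM); exists u.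
  by split=> v; [rewrite -uK | rewrite -Ku] => /=; rewrite fg.
by move=> [Z [h [g' [rh rg fE]]]]; exists Z, h, g'; split=> // v; rewrite -fg fE.
Qed.

Lemma rad_comp_comp p q X Y Z (g : rep_hom Y Z) (f : rep_hom X Y) :
  (0 < p)%N -> (0 < q)%N -> rad_comp p f -> rad_comp q g ->
  rad_comp (p + q) (hom_comp g f).
Proof.
case: p q => // p [] // q _ _.
elim: p X Y f g => [|p IH] X Y f g rf rg; first by exists Y, f, g.
case: rf => [W [h [f' [rh rf' fE]]]].
exists W, h, (hom_comp g f'); split=> //; first exact: IH.
by move=> v; apply/lfunP=> x; rewrite !hom_compE fE !hom_compE.
Qed.

Lemma rad_comp_rad_pow d X Y (f : rep_hom X Y) : rad_comp d f -> rad_pow d f.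
Proof.
move=> radf; exists 1%N, (fun=> f); split=> [i|v]; first exact: radf.
by rewrite big_ord1.
Qed.

(** The weights [w] record how many radical factors each morphism of the
    chain contributes. *)
Lemma rad_comp_chain (w : nat -> nat) (X : nat -> rep k B)
    (h : forall i, rep_hom (X i) (X i.+1)) i l :
  (0 < l)%N ->
  (forall j, (i <= j < l + i)%N -> (0 < w j)%N /\ rad_comp (w j) (h j)) ->
  rad_comp (\sum_(i <= j < l + i) w j) (hom_chain h i l).
Proof.
elim: l => // -[|l] IH _ wP.
  rewrite big_nat1 /=; have [|_] := wP i; first lia.
  by apply: rad_comp_eq => v; apply/lfunP=> x; rewrite hom_compE id_lfunE.
have [|w_gt0 rad_h] := wP (l.+1 + i)%N; first lia.
have -> : (\sum_(i <= j < l.+2 + i) w j =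
          \sum_(i <= j < l.+1 + i) w j + w (l.+1 + i))%N.
  by rewrite addSn big_nat_recr //=; lia.
apply: rad_comp_comp => //; last by apply: IH => // j ?; apply: wP; lia.
rewrite big_ltn; last lia.
by have [|? _] := wP i; lia.
Qed.

(** A filtration of the representations by predicates on the space at [v]
    which every radical morphism shifts by one bounds the depth of the
    morphisms that do not shift it. *)
Lemma rad_comp_shift (v : vertex B) (D : nat -> forall M : rep k B, M v -> Prop) K :
  (forall d X Y (f : rep_hom X Y) x, (d < K)%N -> radical f ->
     D d X x -> D d.+1 Y (f v x)) ->
  forall l d X Y (f : rep_hom X Y) x, (0 < l)%N -> (d + l <= K)%N ->
    rad_comp l f -> D d X x -> D (d + l)%N Y (f v x).
Proof.
move=> shift; elim=> // -[|l] IH d X Y f x _ ledK.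
  by move=> radf Dx; rewrite addn1; apply: shift => //; lia.
move=> [Z [h [g [radh radg fE]]]] Dx; rewrite fE hom_compE addnS -addSn.
apply: IH => //; first by lia.
by apply: shift => //; lia.
Qed.

(** One factor of depth two among radical ones raises the depth of the whole
    composition; read backwards, a composition of minimal depth has all its
    factors outside the square of the radical. *)
Lemma rad_comp_of_factor (X : nat -> rep k B)
    (h : forall i, rep_hom (X i) (X i.+1)) i l j :
  (i <= j < l + i)%N ->
  (forall j, (i <= j < l + i)%N -> radical (h j)) -> rad_comp 2 (h j) ->
  rad_comp l.+1 (hom_chain h i l).
Proof.
move=> ij rad_h rad2.
have -> : l.+1 = (\sum_(i <= j' < l + i) (1 + (j' == j)))%N.
  rewrite big_split /= sum_nat_const_nat.
  rewrite (bigD1_seq j) ?mem_index_iota ?iota_uniq //= eqxx big1; last by move=> t /negPf->.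
  lia.
apply: rad_comp_chain; first lia.
by move=> t tin; case: eqP => [->|_]; split=> //; apply: rad_h.
Qed.
End Radical.

(** * Linear relations along a zigzag of vector spaces *)

Section Functionals.
Variable k : fieldType.

(** The functional [phi \o f^-1] is well defined on [limg f] modulo its
    intersection with [A], since [phi] kills what [f] sends into [A]. Projecting
    onto [limg f] along [A] makes it total. *)
Lemma extend_functional (V V' : vectType k) (f : 'Hom(V, V'))
    (phi : 'Hom(V, k^o)) (A : {vspace V'}) :
  (f @^-1: A <= lker phi)%VS ->
  exists2 phi' : 'Hom(V', k^o), (A <= lker phi')%VS & phi = (phi' \o f)%VF.
Proof.
move=> killA; pose pi := addv_pi1 (limg f) A.
have pi_limg w : f (f^-1%VF (pi w)) = pi w.
  by apply: limg_lfunVK; rewrite memv_pi1.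
have pi_diff w : w \in (limg f + A)%VS -> w - pi w \in A.
  move=> /addv_pi1_pi2 {1}<-; rewrite addrC addKr.
  exact: memv_pi2.
(* [f^-1] is a section of [f] over [limg f], where [pi] takes its values *)
exists (phi \o (f^-1 \o pi))%VF.
  apply/subvP=> w Aw; rewrite memv_ker !comp_lfunE -memv_ker.
  apply: (subvP killA); rewrite -memv_preim pi_limg -[pi w](subKr w).
  by rewrite memvB // pi_diff // (subvP (addvSr _ _)).
apply/lfunP=> x; rewrite !comp_lfunE; apply/eqP.
rewrite -subr_eq0 -linearB -memv_ker.
apply: (subvP killA); rewrite -memv_preim linearB /= pi_limg pi_diff //.
by rewrite (subvP (addvSl _ _)) // memv_img ?memvf.
Qed.

Definition lfun_of_linear (V V' : vectType k) (f : V -> V') (lf : linear f) :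
    'Hom(V, V') :=
  linfun (HB.pack_for {linear V -> V'} f (GRing.isLinear.Build k V V' _ f lf)).

Lemma lfun_of_linearE (V V' : vectType k) (f : V -> V') (lf : linear f) x :
  lfun_of_linear lf x = f x.
Proof. exact: lfunE. Qed.

Lemma scale_linear (V : vectType k) (z : V) : linear (fun c : k^o => c *: z).
Proof. by move=> a b c; rewrite scalerDl scalerA. Qed.

Definition line (V : vectType k) (z : V) : 'Hom(k^o, V) :=
  lfun_of_linear (scale_linear z).

Lemma lineE (V : vectType k) (z : V) c : line z c = c *: z.
Proof. exact: lfun_of_linearE. Qed.

Lemma separating_functional (V : vectType k) (A : {vspace V}) (z : V) :
  z \notin A -> exists2 phi : 'Hom(V, k^o), (A <= lker phi)%VS & phi z = 1.
Proof.
move=> nAz.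
have /extend_functional[phi killA phiE] : (line z @^-1: A <= lker (\1 : 'Hom(k^o, k^o)))%VS.
  apply/subvP=> c; rewrite -memv_preim lineE memv_ker id_lfunE => Acz.
  apply: contraNT nAz => nzc.
  by rewrite -[z](scalerK nzc) memvZ.
exists phi => //; have /lfunP/(_ (1 : k^o)) := phiE.
by rewrite id_lfunE comp_lfunE lineE scale1r.
Qed.

End Functionals.

Section Zigzag.
Variables (k : fieldType) (V : nat -> vectType k) (dir : pred nat).
Variables (fw : forall p, 'Hom(V p, V p.+1)) (bw : forall p, 'Hom(V p.+1, V p)).
Implicit Types (A W : forall p, {vspace V p}) (Y : forall p, V p).
Implicit Types Phi : forall p, 'Hom(V p, k^o).

(** Up to conditions at the ends, linked vectors are the images of the basis
    vectors under a morphism from an interval module, and colinked functionals are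
    the coordinates of a morphism into one. Neighbouring spaces are joined by
    [fw p] or by [bw p], according to [dir]. *)
Definition linked Y p := if dir p then Y p.+1 = fw p (Y p) else Y p = bw p (Y p.+1).

Definition colinked Phi p :=
  if dir p then Phi p = (Phi p.+1 \o fw p)%VF else Phi p.+1 = (Phi p \o bw p)%VF.

Definition pull p (U : {vspace V p.+1}) : {vspace V p} :=
  if dir p then (fw p @^-1: U)%VS else (bw p @: U)%VS.

Definition push p (U : {vspace V p}) : {vspace V p.+1} :=
  if dir p then (fw p @: U)%VS else (bw p @^-1: U)%VS.

(** The vectors at [p] linked to some vector of [A (p + d)] over [d] edges. The
    recursion moves [p] rather than the far end, so that no type has to be
    transported. *)
Fixpoint from_right A d p : {vspace V p} :=
  if d is d'.+1 then pull (from_right A d' p.+1) else A p.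

Fixpoint from_left A d p : {vspace V p} :=
  if d is d'.+1 then
    match p return {vspace V p} with
    | 0 => A 0%N
    | p'.+1 => push (from_left A d' p')
    end
  else A p.

Lemma from_left0 A p : from_left A 0 p = A p.
Proof. by case: p. Qed.

Lemma pull_mono p (U U' : {vspace V p.+1}) : (U <= U' -> pull U <= pull U')%VS.
Proof. by rewrite /pull; case: (dir p); [apply: lpreimS | apply: limgS]. Qed.

Lemma push_mono p (U U' : {vspace V p}) : (U <= U' -> push U <= push U')%VS.
Proof. by rewrite /push; case: (dir p); [apply: limgS | apply: lpreimS]. Qed.

Lemma from_right_mono A A' d p :
  (A (p + d)%N <= A' (p + d)%N)%VS -> (from_right A d p <= from_right A' d p)%VS.
Proof.
elim: d p => [|d IH] p /=; first by rewrite addn0.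
by rewrite addnS -addSn => /IH; apply: pull_mono.
Qed.

Lemma from_left_mono A A' d p : (d <= p)%N ->
  (A (p - d)%N <= A' (p - d)%N)%VS -> (from_left A d p <= from_left A' d p)%VS.
Proof.
elim: d p => [|d IH] [|p] //= dp; rewrite ?subn0 // subSS => /IH sub.
by apply: push_mono; apply: sub.
Qed.

Lemma from_right_trans A d d' p :
  from_right (from_right A d') d p = from_right A (d + d') p.
Proof. by elim: d p => [|d IH] p //=; rewrite IH. Qed.

Lemma from_left_trans A d d' p : (d + d' <= p)%N ->
  from_left (from_left A d') d p = from_left A (d + d') p.
Proof. by elim: d p => [|d IH] [|p] //= ?; rewrite IH. Qed.

Lemma from_right_lift A d p y :
  y \in from_right A d p ->
  exists Y, [/\ Y p = y, forall q, (p <= q < p + d)%N -> linked Y q &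
                forall q, q = (p + d)%N -> Y q \in A q].
Proof.
elim: d p y => [|d IH] p y /=.
  move=> Ay; exists (dfwith (fun q => 0 : V q) y).
  split; first by rewrite dfwith_in.
    by move=> q; lia.
  by move=> q; rewrite addn0 => ->; rewrite dfwith_in.
move=> pull_y.
have [y' Ay' yy'] : exists2 y', y' \in from_right A d p.+1 &
    (if dir p then y' = fw p y else y = bw p y').
  move: pull_y; rewrite /pull; case: (dir p); first by exists (fw p y); rewrite ?memv_preim.
  by move=> /memv_imgP[y' Ay' yE]; exists y'.
have [Y [Yp linkY AY]] := IH _ _ Ay'.
have out q : p != q -> dfwith Y y q = Y q by apply: dfwith_out.
exists (dfwith Y y); split; first by rewrite dfwith_in.
  move=> q qin; have [->|neq] := eqVneq q p.
    by rewrite /linked dfwith_in out ?Yp //; lia.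
  by rewrite /linked !out; [apply: linkY; lia | lia | lia].
move=> q qE; rewrite out; last by lia.
by apply: AY; lia.
Qed.

Lemma from_left_lift A d p y : (d <= p)%N ->
  y \in from_left A d p ->
  exists Y, [/\ Y p = y, forall q, (p - d <= q < p)%N -> linked Y q &
                forall q, q = (p - d)%N -> Y q \in A q].
Proof.
elim: d p y => [|d IH] p y dp.
  rewrite from_left0 => Ay; exists (dfwith (fun q => 0 : V q) y).
  split; first by rewrite dfwith_in.
    by move=> q; lia.
  by move=> q; rewrite subn0 => ->; rewrite dfwith_in.
case: p y dp => // p y dp /= push_y.
have [y' Ay' yy'] : exists2 y', y' \in from_left A d p &
    (if dir p then y = fw p y' else y' = bw p y).
  move: push_y; rewrite /push; case: (dir p); last by exists (bw p y); rewrite ?memv_preim.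
  by move=> /memv_imgP[y' Ay' yE]; exists y'.
have [Y [Yp linkY AY]] := IH _ _ dp Ay'.
have out q : p.+1 != q -> dfwith Y y q = Y q by apply: dfwith_out.
exists (dfwith Y y); split; first by rewrite dfwith_in.
  move=> q qin; have [->|neq] := eqVneq q p.
    by rewrite /linked dfwith_in out ?Yp //; lia.
  by rewrite /linked !out; [apply: linkY; lia | lia | lia].
move=> q qE; rewrite out; last by lia.
by apply: AY; lia.
Qed.

(** A functional at [p] can be continued along the edges under the same
    recursion that governs the continuation of vectors; only the condition at
    the far end differs. So the vectors that escape the functionals of one string
    can be compared with the vectors reached from the next one. *)
Lemma from_right_colift A d p (phi : 'Hom(V p, k^o)) :
  (from_right A d p <= lker phi)%VS ->
  exists Phi, [/\ Phi p = phi, forall q, (p <= q < p + d)%N -> colinked Phi q &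
                forall q, q = (p + d)%N -> (A q <= lker (Phi q))%VS].
Proof.
elim: d p phi => [|d IH] p phi /=.
  move=> killA; exists (dfwith (fun q => 0 : 'Hom(V q, k^o)) phi).
  split; first by rewrite dfwith_in.
    by move=> q; lia.
  by move=> q; rewrite addn0 => ->; rewrite dfwith_in.
move=> kill_pull.
have [phi' kill' phiE] : exists2 phi' : 'Hom(V p.+1, k^o),
    (from_right A d p.+1 <= lker phi')%VS &
    (if dir p then phi = (phi' \o fw p)%VF else phi' = (phi \o bw p)%VF).
  move: kill_pull; rewrite /pull; case: (dir p); first exact: extend_functional.
  move=> kill; exists (phi \o bw p)%VF => //; apply/subvP=> x Ax.
  by rewrite memv_ker comp_lfunE -memv_ker (subvP kill) // memv_img.
have [Phi [Phip linkPhi AP]] := IH _ _ kill'.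
have out q : p != q -> dfwith Phi phi q = Phi q by apply: dfwith_out.
exists (dfwith Phi phi); split; first by rewrite dfwith_in.
  move=> q qin; have [->|neq] := eqVneq q p.
    by rewrite /colinked dfwith_in out ?Phip //; lia.
  by rewrite /colinked !out; [apply: linkPhi; lia | lia | lia].
move=> q qE; rewrite out; last by lia.
by apply: AP; lia.
Qed.

Lemma from_left_colift A d p (phi : 'Hom(V p, k^o)) : (d <= p)%N ->
  (from_left A d p <= lker phi)%VS ->
  exists Phi, [/\ Phi p = phi, forall q, (p - d <= q < p)%N -> colinked Phi q &
                forall q, q = (p - d)%N -> (A q <= lker (Phi q))%VS].
Proof.
elim: d p phi => [|d IH] p phi dp.
  rewrite from_left0 => killA; exists (dfwith (fun q => 0 : 'Hom(V q, k^o)) phi).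
  split; first by rewrite dfwith_in.
    by move=> q; lia.
  by move=> q; rewrite subn0 => ->; rewrite dfwith_in.
case: p phi dp => // p phi dp /= kill_push.
have [phi' kill' phiE] : exists2 phi' : 'Hom(V p, k^o),
    (from_left A d p <= lker phi')%VS &
    (if dir p then phi' = (phi \o fw p)%VF else phi = (phi' \o bw p)%VF).
  move: kill_push; rewrite /push; case: (dir p); last exact: extend_functional.
  move=> kill; exists (phi \o fw p)%VF => //; apply/subvP=> x Ax.
  by rewrite memv_ker comp_lfunE -memv_ker (subvP kill) // memv_img.
have [Phi [Phip linkPhi AP]] := IH _ _ dp kill'.
have out q : p.+1 != q -> dfwith Phi phi q = Phi q by apply: dfwith_out.
exists (dfwith Phi phi); split; first by rewrite dfwith_in.
  move=> q qin; have [->|neq] := eqVneq q p.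
    by rewrite /colinked dfwith_in out ?Phip //; lia.
  by rewrite /colinked !out; [apply: linkPhi; lia | lia | lia].
move=> q qE; rewrite out; last by lia.
by apply: AP; lia.
Qed.

Lemma linked_from_left A Y d p : (d <= p)%N ->
  (forall q, (p - d <= q < p)%N -> linked Y q) ->
  Y (p - d)%N \in A (p - d)%N -> Y p \in from_left A d p.
Proof.
elim: d p => [|d IH] [|p] //= dp linkY.
rewrite subSS => AY; have {IH}: Y p \in from_left A d p.
  by apply: IH => // q qin; apply: linkY; lia.
have := linkY p; rewrite /linked /push ltnSn andbT => linkp.
have {linkp} := linkp ltac:(lia).
case: (dir p) => YE AYp; first by rewrite YE memv_img.
by rewrite -memv_preim -YE.
Qed.

Lemma colinked_from_right A Phi d p :
  (forall q, (p <= q < p + d)%N -> colinked Phi q) ->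
  (A (p + d)%N <= lker (Phi (p + d)%N))%VS ->
  (from_right A d p <= lker (Phi p))%VS.
Proof.
elim: d p => [|d IH] p /= linkP; first by rewrite addn0.
rewrite addnS -addSn => killA; have {IH}: (from_right A d p.+1 <= lker (Phi p.+1))%VS.
  by apply: IH => // q qin; apply: linkP; lia.
have := linkP p; rewrite /colinked /pull => linkp.
have {linkp} := linkp ltac:(lia).
case: (dir p) => PE /subvP kill; apply/subvP=> x.
  by rewrite -memv_preim PE => /kill; rewrite !memv_ker comp_lfunE.
by move=> /memv_imgP[y /kill]; rewrite PE !memv_ker comp_lfunE => ? ->.
Qed.

End Zigzag.

Section ZigzagMorphism.
Variables (k : fieldType) (V V' : nat -> vectType k) (dir : pred nat).
Variables (fw : forall p, 'Hom(V p, V p.+1)) (bw : forall p, 'Hom(V p.+1, V p)).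
Variables (fw' : forall p, 'Hom(V' p, V' p.+1)) (bw' : forall p, 'Hom(V' p.+1, V' p)).
Variable f : forall p, 'Hom(V p, V' p).
Hypothesis f_fw : forall p x, f p.+1 (fw p x) = fw' p (f p x).
Hypothesis f_bw : forall p x, f p (bw p x) = bw' p (f p.+1 x).

Lemma from_right_natural (A : forall p, {vspace V p}) (A' : forall p, {vspace V' p})
    d p x :
  (forall q x, x \in A q -> f q x \in A' q) ->
  x \in from_right dir fw bw A d p -> f p x \in from_right dir fw' bw' A' d p.
Proof.
move=> fA; elim: d p x => [|d IH] p x /=; first exact: fA.
rewrite /pull; case: (dir p).
  by rewrite -!memv_preim -f_fw; apply: IH.
by move=> /memv_imgP[y /IH fy ->]; rewrite f_bw memv_img.
Qed.

Lemma from_left_natural (A : forall p, {vspace V p}) (A' : forall p, {vspace V' p})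
    d p x :
  (forall q x, x \in A q -> f q x \in A' q) ->
  x \in from_left dir fw bw A d p -> f p x \in from_left dir fw' bw' A' d p.
Proof.
move=> fA; elim: d p x => [|d IH] [|p] x /=; try exact: fA.
rewrite /push; case: (dir p); last by rewrite -!memv_preim -f_bw; apply: IH.
by move=> /memv_imgP[y /IH fy ->]; rewrite f_fw memv_img.
Qed.

End ZigzagMorphism.

(** * Vertices and arrows along the maximal string *)

Section Transport.
Variables (k : fieldType) (B : bound_quiver).
Implicit Types M X Y : rep k B.

(** Total in both vertices, so that the two ends of an edge may be given by
    expressions that are only provably the ends of an arrow. *)
Definition transport M (u v : vertex B) : 'Hom(M u, M v) :=
  if @eqP _ u v is ReflectT e then ecast w 'Hom(M u, M w) e \1%VF else 0.

Lemma transport_refl M u (x : M u) : transport M u u x = x.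
Proof. by rewrite /transport; case: eqP => // e; rewrite eq_axiomK /= id_lfunE. Qed.

Lemma transport_neq M u v (x : M u) : u != v -> transport M u v x = 0.
Proof. by rewrite /transport; case: eqP => // _ _; rewrite zero_lfunE. Qed.

Lemma transport_natural X Y (f : rep_hom X Y) u v x :
  f v (transport X u v x) = transport Y u v (f u x).
Proof.
have [<-|neq] := eqVneq u v; first by rewrite !transport_refl.
by rewrite !transport_neq // linear0.
Qed.

Lemma transport_trans M u v w (x : M u) : u = v ->
  transport M v w (transport M u v x) = transport M u w x.
Proof. by move=> <-; rewrite transport_refl. Qed.

(** The action of the arrow from [u] to [v]: the sum has at most one term in a
    quiver without parallel arrows. *)
Definition step M (u v : vertex B) : 'Hom(M u, M v) :=
  \sum_(a : arrow B | (src a == u) && (tgt a == v))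
    (transport M (tgt a) v \o rep_map M a \o transport M u (src a))%VF.

Lemma step_natural X Y (f : rep_hom X Y) u v x :
  f v (step X u v x) = step Y u v (f u x).
Proof.
rewrite /step !sum_lfunE linear_sum /=; apply: eq_bigr => a _.
by rewrite !comp_lfunE transport_natural hom_natural transport_natural.
Qed.

Lemma step_transport M u v w (x : M u) : u = w ->
  step M w v (transport M u w x) = step M u v x.
Proof. by move=> <-; rewrite transport_refl. Qed.

Lemma transport_step M u v w (x : M u) : v = w ->
  transport M v w (step M u v x) = step M u w x.
Proof. by move=> <-; rewrite transport_refl. Qed.

Hypothesis arrow_inj :
  forall a b : arrow B, src a = src b -> tgt a = tgt b -> a = b.

Lemma step_rep_map M (a : arrow B) x : step M (src a) (tgt a) x = rep_map M a x.
Proof.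
rewrite /step (big_pred1 a) => [|b]; last first.
  by apply/andP/eqP => [[/eqP sE /eqP tE]|->]; [apply: arrow_inj | rewrite !eqxx].
by rewrite !comp_lfunE !transport_refl.
Qed.

End Transport.

Section Positions.
Variables (m n : nat) (hm : (2 <= m)%N) (hn : (2 <= n)%N).
Local Notation U := (U_bound m n.-1).
Local Notation N := (m + n)%N.

(** The longest walk that avoids the relation: it starts at [a_m] (position 0),
    follows [gamma_m] to [x] (position 1), climbs the beta path to [1]
    (position [n]) and follows the gamma path down to [a_m] again (position
    [N - 1]). Only [a_m] is met twice. *)
Definition pos_vertex (q : nat) : vertex U :=
  if q == 0%N then gamma_vertex m n.-1 m.-1
  else if (q <= n)%N then beta_vertex m n.-1 (n - q)
  else gamma_vertex m n.-1 (q - n).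

(** The last position of a vertex: an injective numbering which turns
    equalities between vertices into arithmetic. *)
Definition vertex_pos (v : vertex U) : nat :=
  match v with
  | U1 => n
  | Ua j => n.+1 + j
  | Ub j => n.-1 - j
  | Ux => 1
  end.

Lemma vertex_pos_inj : injective vertex_pos.
Proof.
move=> [|[i Hi]|[i Hi]|] [|[j Hj]|[j Hj]|] //= E; try (exfalso; lia).
all: have ij : i = j by lia.
all: by subst j; rewrite (bool_irrelevance Hi Hj).
Qed.

Lemma vertex_pos_gamma i : (i <= m)%N ->
  vertex_pos (gamma_vertex m n.-1 i) = if i == m then 1%N else (n + i)%N.
Proof.
case: i => [|i] im /=; first by case: eqP; lia.
case: insubP => [j ij jE|] /=; first by rewrite jE; case: eqP; lia.
by rewrite -leqNgt => ?; case: eqP; lia.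
Qed.

Lemma vertex_pos_beta i : (i < n)%N -> vertex_pos (beta_vertex m n.-1 i) = (n - i)%N.
Proof.
case: i => [|i] ile /=; first by lia.
by case: insubP => [j ij jE|] /=; [rewrite jE | rewrite -leqNgt => ?]; lia.
Qed.

Lemma vertex_pos_pos q : (q < N)%N ->
  vertex_pos (pos_vertex q) = if q == 0%N then N.-1 else q.
Proof.
move=> qN; rewrite /pos_vertex; case: eqP => [_|q0].
  by rewrite vertex_pos_gamma; [case: eqP|]; lia.
case: leqP => qn; first by rewrite vertex_pos_beta; lia.
by rewrite vertex_pos_gamma; [case: eqP|]; lia.
Qed.

Lemma vertex_pos_src (a : arrow U) : vertex_pos (src a) =
  match a with inl i => (n + i)%N | inr i => (n - i)%N end.
Proof.
case: a => i; have := ltn_ord i => ilt /=.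
  by rewrite vertex_pos_gamma; [case: eqP|]; lia.
by rewrite vertex_pos_beta; lia.
Qed.

Lemma vertex_pos_tgt (a : arrow U) : vertex_pos (tgt a) =
  match a with
  | inl i => if i.+1 == m then 1%N else (n + i).+1
  | inr i => (n - i.+1)%N
  end.
Proof.
case: a => i; have := ltn_ord i => ilt.
  by rewrite -[tgt _]/(gamma_vertex m n.-1 i.+1) vertex_pos_gamma //; case: eqP; lia.
by rewrite -[tgt _]/(beta_vertex m n.-1 i.+1) vertex_pos_beta; lia.
Qed.

Lemma arrow_inj (a b : arrow U) : src a = src b -> tgt a = tgt b -> a = b.
Proof.
move=> /(congr1 vertex_pos) + /(congr1 vertex_pos).
rewrite !vertex_pos_src !vertex_pos_tgt.
case: a b => [i|i] [j|j]; have := ltn_ord i; have := ltn_ord j => ? ?;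
  try case: eqP; try case: eqP; move=> *; try (exfalso; lia);
  have -> // : i = j by apply: val_inj => /=; lia.
Qed.

(** The edge between the positions [q] and [q.+1] points to the right when
    it belongs to the gamma path. *)
Definition rightward q := (q == 0%N) || (n <= q)%N.

Definition next_pos (a : arrow U) q := if a is inl _ then q.+1 else q.-1.

Lemma edge_arrow q : (q.+1 < N)%N ->
  exists a : arrow U, if rightward q
    then [/\ src a = pos_vertex q, tgt a = pos_vertex q.+1 &
             forall r, next_pos a r = r.+1]
    else [/\ src a = pos_vertex q.+1, tgt a = pos_vertex q &
             forall r, next_pos a r = r.-1].
Proof.
move=> qN; rewrite /rightward.
have [q0|q0] := eqVneq q 0%N.
  have lt : (m.-1 < m)%N by lia.
  exists (inl (Ordinal lt)); split=> //; apply: vertex_pos_inj.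
    by rewrite vertex_pos_src vertex_pos_pos //=; try case: eqP; lia.
  by rewrite vertex_pos_tgt vertex_pos_pos //=; try case: eqP; lia.
rewrite orFb; case: leqP => nq.
  have lt : (q - n < m)%N by lia.
  exists (inl (Ordinal lt)); split=> //; apply: vertex_pos_inj.
    by rewrite vertex_pos_src vertex_pos_pos //=; try case: eqP; lia.
  by rewrite vertex_pos_tgt vertex_pos_pos //=; try case: eqP; lia.
have lt : (n - q.+1 < n.-1)%N by lia.
exists (inr (Ordinal lt)); split=> //; apply: vertex_pos_inj.
  by rewrite vertex_pos_src vertex_pos_pos /=; lia.
by rewrite vertex_pos_tgt vertex_pos_pos //=; try case: eqP; lia.
Qed.

Lemma pos_vertex_last : pos_vertex N.-1 = pos_vertex 0.
Proof. by apply: vertex_pos_inj; rewrite !vertex_pos_pos /=; [case: eqP|..]; lia. Qed.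

(** An arrow leaving the vertex at position [q] runs along the walk, except
    for [gamma_m], which leaves [a_m] but cannot be followed from the last
    position because of the relation. *)
Variant out_arrow q (a : arrow U) : Prop :=
  | OutRight i of a = inl i & rightward q & (q.+1 < N)%N & pos_vertex q.+1 = tgt a
  | OutLeft i of a = inr i & (0 < q)%N & ~~ rightward q.-1 & pos_vertex q.-1 = tgt a
  | OutLast i of a = inl i & q = N.-1 & pos_vertex 1 = tgt a.

Lemma out_arrowP q (a : arrow U) : (q < N)%N -> pos_vertex q = src a -> out_arrow q a.
Proof.
move=> qN /(congr1 vertex_pos); rewrite vertex_pos_pos // vertex_pos_src.
case: a => i; have := ltn_ord i => ilt qE.
  have [im|im] := eqVneq i.+1 m.
    have [q0|q0] := eqVneq q 0%N.
      apply: (@OutRight _ _ i) => //; [by rewrite q0|lia|].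
      apply: vertex_pos_inj; rewrite vertex_pos_pos; last by lia.
      by rewrite vertex_pos_tgt im eqxx q0.
    apply: (@OutLast _ _ i) => //; first by move: qE; rewrite (negPf q0); lia.
    apply: vertex_pos_inj; rewrite vertex_pos_pos; last by lia.
    by rewrite vertex_pos_tgt im eqxx.
  have q0 : (q == 0%N) = false by apply: contraNF im => /eqP q0; move: qE; rewrite q0 /=; lia.
  rewrite q0 in qE; apply: (@OutRight _ _ i) => //; [by rewrite /rightward qE leq_addr orbT|lia|].
  apply: vertex_pos_inj; rewrite vertex_pos_pos; last by lia.
  by rewrite vertex_pos_tgt (negPf im) qE.
have q0 : (q == 0%N) = false by apply/eqP => q0; move: qE; rewrite q0 /=; lia.
rewrite q0 in qE; apply: (@OutLeft _ _ i) => //; [lia|rewrite /rightward; lia|].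
apply: vertex_pos_inj; rewrite vertex_pos_pos; last by lia.
by rewrite vertex_pos_tgt; case: eqP => ?; lia.
Qed.

(** Dually, [gamma_(m-1)] enters [a_m] but not along the walk at position 0. *)
Variant in_arrow q (a : arrow U) : Prop :=
  | InRight i of a = inl i & (0 < q)%N & rightward q.-1 & pos_vertex q.-1 = src a
  | InLeft i of a = inr i & (q.+1 < N)%N & ~~ rightward q & pos_vertex q.+1 = src a
  | InFirst i of a = inl i & q = 0%N & pos_vertex N.-2 = src a.

Lemma in_arrowP q (a : arrow U) : (q < N)%N -> pos_vertex q = tgt a -> in_arrow q a.
Proof.
move=> qN /(congr1 vertex_pos); rewrite vertex_pos_pos // vertex_pos_tgt.
case: a => i; have := ltn_ord i => ilt; last first.
  case: eqP => q0 qE; first by lia.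
  apply: (@InLeft _ _ i) => //; [lia|rewrite /rightward; lia|].
  by apply: vertex_pos_inj; rewrite vertex_pos_pos ?vertex_pos_src /=; lia.
case: (i.+1 =P m) => im; case: eqP => q0 qE; try lia.
- apply: (@InRight _ _ i) => //; [lia|by rewrite qE|].
  by apply: vertex_pos_inj; rewrite vertex_pos_pos ?vertex_pos_src qE /=; lia.
- apply: (@InFirst _ _ i) => //.
  apply: vertex_pos_inj; rewrite vertex_pos_pos ?vertex_pos_src; last by lia.
  by case: eqP; lia.
apply: (@InRight _ _ i) => //; [lia|rewrite /rightward; lia|].
apply: vertex_pos_inj; rewrite vertex_pos_pos ?vertex_pos_src; last by lia.
by case: eqP; lia.
Qed.

Lemma same_vertex q r : (q < N)%N -> (r < N)%N -> pos_vertex q = pos_vertex r ->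
  [\/ q = r, (q = 0 /\ r = N.-1)%N | (q = N.-1 /\ r = 0)%N].
Proof.
move=> qN rN /(congr1 vertex_pos); rewrite !vertex_pos_pos //.
by case: eqP; case: eqP => ? ? ?; [apply: Or31 | apply: Or32 | apply: Or33 | apply: Or31]; lia.
Qed.

End Positions.

Section StringModules.
Variables (k : fieldType) (m n : nat) (hm : (2 <= m)%N) (hn : (2 <= n)%N).
Local Notation U := (U_bound m n.-1).
Local Notation N := (m + n)%N.
Local Notation pv := (pos_vertex m n).
Local Notation fw M q := (step M (pv q) (pv q.+1)).
Local Notation bw M q := (step M (pv q.+1) (pv q)).
Local Notation rw := (rightward n).
Implicit Types (I : nat * nat) (v : vertex U) (q r : nat) (M X Y : rep k U).

Definition in_interval I q := (I.1 <= q <= I.2)%N.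

Definition at_vertex I v q := [&& (q < N)%N, pv q == v & in_interval I q].

Lemma at_vertexE I v q : (q < N)%N -> pv q = v -> at_vertex I v q = in_interval I q.
Proof. by move=> qN <-; rewrite /at_vertex qN eqxx. Qed.

(** Functions on the positions of the interval that lie over [v]: at most one
    position, except for the two over [a_m]. *)
Definition string_space I v : vectType k :=
  {ffun {q : 'I_N | at_vertex I v q} -> k^o}.

Definition unit_vec I v q : string_space I v := [ffun s => (val (val s) == q)%:R : k^o].

Definition entry_fun I v q (t : string_space I v) : k^o :=
  if insub q is Some i then
    if @insub 'I_N _ {q : 'I_N | at_vertex I v q} i is Some s then t s else 0
  else 0.

Lemma entry_linear I v q : linear (@entry_fun I v q).
Proof.
move=> c t t'; rewrite /entry_fun; case: insub => [i|]; last by rewrite scaler0 addr0.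
by case: insub => [s|]; [rewrite !ffunE | rewrite scaler0 addr0].
Qed.

Definition entry I v q : 'Hom(string_space I v, k^o) := lfun_of_linear (@entry_linear I v q).

Lemma entry_val I v (s : {q : 'I_N | at_vertex I v q}) (t : string_space I v) :
  entry I v (val (val s)) t = t s.
Proof. by rewrite lfun_of_linearE /entry_fun !valK. Qed.

Lemma entry_out I v q t : ~~ at_vertex I v q -> entry I v q t = 0.
Proof.
move=> nvq; rewrite lfun_of_linearE /entry_fun; case: insubP => // i _ iq.
by case: insubP => // s; rewrite iq (negPf nvq).
Qed.

Lemma at_vertexP I v q : at_vertex I v q ->
  exists s : {q : 'I_N | at_vertex I v q}, val (val s) = q.
Proof.
move=> vq; have qN : (q < N)%N by case/and3P: vq.
by exists (exist (fun q : 'I_N => at_vertex I v q) (Ordinal qN) vq).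
Qed.

Lemma entry_ext I v (t t' : string_space I v) :
  (forall q, at_vertex I v q -> entry I v q t = entry I v q t') -> t = t'.
Proof.
move=> eqt; apply/ffunP=> s; rewrite -!entry_val; apply: eqt; exact: valP s.
Qed.

Lemma entry_unit I v q r :
  entry I v q (unit_vec I v r) = (at_vertex I v q && (q == r))%:R.
Proof.
have [vq|nvq] := boolP (at_vertex I v q); last by rewrite entry_out.
by have [s <-] := at_vertexP vq; rewrite entry_val ffunE.
Qed.

Lemma unit_vec_out I v q : ~~ at_vertex I v q -> unit_vec I v q = 0.
Proof.
move=> nvq; apply: entry_ext => r vr; rewrite entry_unit vr linear0.
by case: eqP => // rq; rewrite -rq vr in nvq.
Qed.

Lemma unit_vec_sum I v (t : string_space I v) :
  t = \sum_(q < N) entry I v q t *: unit_vec I v q.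
Proof.
apply: entry_ext => q vq; rewrite linear_sum /=.
have qN : (q < N)%N by case/and3P: vq.
rewrite (bigD1 (Ordinal qN)) //= big1 ?addr0 => [|r neq].
  by rewrite linearZ /= entry_unit vq eqxx [_ *: _]mulr1.
rewrite linearZ /= entry_unit vq; case: eqP => [qr|_]; last exact: mulr0.
by case/eqP: neq; apply: val_inj.
Qed.

Lemma unit_vec_ext I v (W : vectType k) (f g : 'Hom(string_space I v, W)) :
  (forall q, at_vertex I v q -> f (unit_vec I v q) = g (unit_vec I v q)) -> f = g.
Proof.
move=> eqfg; apply/lfunP=> t; rewrite [t]unit_vec_sum !linear_sum /=.
apply: eq_bigr => q _; rewrite !linearZ /=.
by have [/eqfg->//|/unit_vec_out->] := boolP (at_vertex I v q); rewrite !linear0.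
Qed.

Definition string_lfun I v (W : vectType k) (y : nat -> W) : 'Hom(string_space I v, W) :=
  \sum_(q < N) (line (y q) \o entry I v q)%VF.

Lemma string_lfunE I v (W : vectType k) (y : nat -> W) t :
  string_lfun I v y t = \sum_(q < N) entry I v q t *: y q.
Proof. by rewrite sum_lfunE; apply: eq_bigr => q _; rewrite comp_lfunE lineE. Qed.

Lemma string_lfun_unit I v (W : vectType k) (y : nat -> W) q :
  at_vertex I v q -> string_lfun I v y (unit_vec I v q) = y q.
Proof.
move=> vq; rewrite string_lfunE; have qN : (q < N)%N by case/and3P: vq.
rewrite (bigD1 (Ordinal qN)) //= entry_unit vq eqxx scale1r big1 ?addr0 // => r neq.
rewrite entry_unit; case: eqP => [rq|_]; last by rewrite andbF scale0r.
by case/eqP: neq; apply: val_inj.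
Qed.

Definition string_map I (a : arrow U) :
    'Hom(string_space I (src a), string_space I (tgt a)) :=
  string_lfun I (src a) (fun q => unit_vec I (tgt a) (next_pos a q)).

(** The two arrows of the relation lead from position [N - 2] past the last
    position. *)
Lemma string_bound I u v (p : @qpath U u v) :
  U_rel p -> Defs.path_map (string_map I) p = 0.
Proof.
case: u v p / => i lt0 lt1 im /=; rewrite comp_lfun1l.
apply: (@unit_vec_ext I (src (inl (Ordinal lt0) : arrow U))) => q vq.
rewrite comp_lfunE zero_lfunE string_lfun_unit //.
have [vq1|/unit_vec_out->] :=
  boolP (at_vertex I (tgt (inl (Ordinal lt0) : arrow U)) q.+1); last by rewrite linear0.
have vq1' : at_vertex I (src (inl (Ordinal lt1) : arrow U)) q.+1 by [].
apply: etrans (string_lfun_unit _ vq1') _; apply: unit_vec_out.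
apply/negP=> /and3P[q2N _ _].
case/and3P: vq1 => q1N /eqP/(congr1 (@vertex_pos m n)).
rewrite vertex_pos_pos // vertex_pos_tgt //= => + _.
have -> : (i.+1 == m) = false by lia.
move: q2N => /=; lia.
Qed.

Definition string_rep I : rep k U := Rep (@string_bound I).

Lemma at_vertex_pos I q : (q < N)%N -> in_interval I q -> at_vertex I (pv q) q.
Proof. by move=> qN Iq; rewrite /at_vertex qN eqxx. Qed.

Lemma rep_map_unit I (a : arrow U) q : at_vertex I (src a) q ->
  rep_map (string_rep I) a (unit_vec I (src a) q) = unit_vec I (tgt a) (next_pos a q).
Proof. exact: string_lfun_unit. Qed.

Lemma step_unit I u v (a : arrow U) q : src a = u -> tgt a = v -> at_vertex I u q ->
  step (string_rep I) u v (unit_vec I u q) = unit_vec I v (next_pos a q).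
Proof.
move=> <- <- vq; rewrite step_rep_map; first exact: rep_map_unit.
exact: arrow_inj.
Qed.

Lemma fw_unit I q : (q.+1 < N)%N -> rw q -> in_interval I q ->
  fw (string_rep I) q (unit_vec I (pv q) q) = unit_vec I (pv q.+1) q.+1.
Proof.
move=> qN rq Iq; have [a] := edge_arrow hm hn qN; rewrite rq => -[srcE tgtE nextE].
by rewrite (step_unit srcE tgtE) ?nextE ?at_vertex_pos //; lia.
Qed.

Lemma bw_unit I q : (q.+1 < N)%N -> ~~ rw q -> in_interval I q.+1 ->
  bw (string_rep I) q (unit_vec I (pv q.+1) q.+1) = unit_vec I (pv q) q.
Proof.
move=> qN /negPf rq Iq; have [a] := edge_arrow hm hn qN; rewrite rq => -[srcE tgtE nextE].
by rewrite (step_unit srcE tgtE) ?nextE ?at_vertex_pos.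
Qed.

Lemma entry_fw I q t : (q.+1 < N)%N -> rw q -> in_interval I q.+1 ->
  entry I (pv q.+1) q.+1 (fw (string_rep I) q t) = entry I (pv q) q t.
Proof.
move=> qN rq Iq; have [a] := edge_arrow hm hn qN; rewrite rq => -[srcE tgtE nextE].
rewrite -comp_lfunE; move: t; apply/lfunP; apply: unit_vec_ext => r vr.
rewrite comp_lfunE (step_unit srcE tgtE) // nextE !entry_unit at_vertex_pos // eqSS.
by case: eqP vr => [<-|_] vr; rewrite ?andbF // vr.
Qed.

Lemma entry_bw I q t : (q.+1 < N)%N -> ~~ rw q -> in_interval I q ->
  entry I (pv q) q (bw (string_rep I) q t) = entry I (pv q.+1) q.+1 t.
Proof.
move=> qN rq Iq; have [a] := edge_arrow hm hn qN.
rewrite (negPf rq) => -[srcE tgtE nextE].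
rewrite -comp_lfunE; move: t; apply/lfunP; apply: unit_vec_ext => r vr.
rewrite comp_lfunE (step_unit srcE tgtE) // nextE !entry_unit at_vertex_pos //; last by lia.
have r_gt0 : (0 < r)%N.
  case/and3P: vr => rN /eqP prE _; rewrite lt0n; apply/eqP => r0.
  move: rq; rewrite /rightward negb_or -ltnNge => /andP[_ qn].
  by case: (same_vertex hm hn rN qN prE); lia.
have -> : (q == r.-1) = (q.+1 == r) by lia.
by case: eqP vr => [<-|_] vr; rewrite ?andbF // vr.
Qed.

Lemma entry_unit_diag I q : (q < N)%N -> in_interval I q ->
  entry I (pv q) q (unit_vec I (pv q) q) = 1.
Proof. by move=> qN Iq; rewrite entry_unit eqxx at_vertex_pos. Qed.

(** The diagonal coefficients of an endomorphism agree along every edge of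
    the string, so it is a scalar plus a nilpotent: the only off-diagonal
    coefficient that survives sends position 0 to the last position. *)
Lemma string_endo_inj I (psi : rep_hom (string_rep I) (string_rep I)) p :
  (I.2 < N)%N -> in_interval I p ->
  entry I (pv p) p (psi (pv p) (unit_vec I (pv p) p)) != 0 ->
  forall v, lker (psi v) == 0%VS.
Proof.
move=> IN Ip; pose diag q := entry I (pv q) q (psi (pv q) (unit_vec I (pv q) q)).
have diagS q : in_interval I q -> in_interval I q.+1 -> diag q = diag q.+1.
  move=> Iq Iq1; have qN : (q.+1 < N)%N by case/andP: Iq1; lia.
  have [rq|rq] := boolP (rw q).
    by rewrite /diag -(fw_unit qN rq Iq) step_natural entry_fw.
  by rewrite /diag -(bw_unit qN rq Iq1) step_natural entry_bw.
have diagE q : in_interval I q -> diag q = diag I.1.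
  rewrite /in_interval; elim: q => [|q IH] Iq; first by congr diag; lia.
  have [->//|neq] := eqVneq q.+1 I.1.
  by rewrite -diagS ?IH /in_interval //; lia.
rewrite -/(diag p) diagE // => nz v; apply/lker0P.
have same q r : at_vertex I v q -> at_vertex I v r ->
    [\/ q = r, (q = 0 /\ r = N.-1)%N | (q = N.-1 /\ r = 0)%N].
  move=> /and3P[qN /eqP pq _] /and3P[rN /eqP pr _].
  by apply: same_vertex => //; rewrite pq pr.
have diag_at q : at_vertex I v q -> entry I v q (psi v (unit_vec I v q)) = diag I.1.
  by move=> /and3P[_ /eqP<- Iq]; rewrite -(diagE q).
apply: (raddf_inj (f := psi v)) => t psi0.
have coef q : at_vertex I v q ->
    0 = entry I v q t * diag I.1 +
        \sum_(r < N | r != q :> nat) entry I v r t * entry I v q (psi v (unit_vec I v r)).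
  move=> vq; have qN : (q < N)%N by case/and3P: vq.
  transitivity (entry I v q (psi v t)); first by rewrite psi0 linear0.
  rewrite [in LHS](unit_vec_sum t) !linear_sum /= (bigD1 (Ordinal qN)) //= !linearZ /=.
  by rewrite diag_at //; congr (_ + _); apply: eq_big => [r|r _]; rewrite ?linearZ.
(* position 0 comes first, as the matrix is triangular with respect to it *)
have t0 : entry I v 0 t = 0.
  have [v0|/entry_out->//] := boolP (at_vertex I v 0).
  move: (coef 0%N v0); rewrite big1 ?addr0 => [/esym/eqP|r r0].
    by rewrite mulf_eq0 (negPf nz) orbF => /eqP.
  have [vr|/entry_out->] := boolP (at_vertex I v r); last by rewrite mul0r.
  have rE : (r : nat) = N.-1 by case: (same _ _ v0 vr); lia.
  suff -> : entry I v 0 (psi v (unit_vec I v r)) = 0 by rewrite mulr0.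
  case/and3P: (v0) => _ /eqP vE I0; case/and3P: (vr) => rN _ Ir.
  rewrite -vE in vr *.
  have N1 : (1 < N)%N by lia.
  have I1 : in_interval I 1 by move: I0 Ir; rewrite /in_interval; lia.
  have rw0 : rw 0 by [].
  rewrite -(entry_fw _ N1 rw0 I1) -step_natural.
  have [a] := edge_arrow hm hn N1; rewrite rw0 => -[srcE tgtE nextE].
  rewrite (step_unit srcE tgtE vr) nextE unit_vec_out ?linear0 //.
  by apply/and3P => -[]; lia.
apply: entry_ext => q vq; rewrite linear0.
have [->//|q0] := eqVneq q 0%N.
move: (coef q vq); rewrite big1 ?addr0 => [/esym/eqP|r rq].
  by rewrite mulf_eq0 (negPf nz) orbF => /eqP.
have [vr|/entry_out->] := boolP (at_vertex I v r); last by rewrite mul0r.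
by case: (same _ _ vq vr) => [?|[? _]|[_ ->]]; [lia | lia | rewrite t0 mul0r].
Qed.

(** * Morphisms between string modules *)

Local Notation string I := (string_rep I).

Lemma string_indecomposable I :
  (I.1 <= I.2)%N -> (I.2 < N)%N -> indecomposable (string I).
Proof.
move=> I12 IN; have I1 : in_interval I I.1 by rewrite /in_interval leqnn.
refine (@indecomposable_of_coef _ _ (string I) (pv I.1) (unit_vec I (pv I.1) I.1)
          (entry I (pv I.1) I.1) _ _).
  by rewrite entry_unit_diag ?oner_neq0 //; lia.
by move=> psi; apply: string_endo_inj.
Qed.

Lemma string_lfun_unit_if I v (W : vectType k) (y : nat -> W) q :
  string_lfun I v y (unit_vec I v q) = (at_vertex I v q)%:R *: y q.
Proof.
have [vq|nvq] := boolP (at_vertex I v q); first by rewrite string_lfun_unit ?scale1r.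
by rewrite unit_vec_out // linear0 scale0r.
Qed.

Lemma rep_map_unit_if I (a : arrow U) q :
  rep_map (string I) a (unit_vec I (src a) q) =
  (at_vertex I (src a) q)%:R *: unit_vec I (tgt a) (next_pos a q).
Proof. exact: string_lfun_unit_if. Qed.

(** The inclusions and projections between interval modules all have the
    form of the identity on common basis vectors; this is a morphism when the
    common interval is a quotient of the first and a sub of the second. *)
Definition compatible I I' : bool :=
  all (fun q => if rw q
        then in_interval I q && in_interval I' q.+1 ==>
             (in_interval I q.+1 == in_interval I' q)
        else in_interval I q.+1 && in_interval I' q ==>
             (in_interval I q == in_interval I' q.+1))
      (iota 0 N.-1).

(** The identity on common basis vectors, scaled by [b], plus [c] times the
    morphism from position 0 to position [N - 1], which factors through the
    simple module at [a_m]. The first summand is dropped when it is not a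
    morphism, so that the definition is total. *)
Definition string_hom_fun I I' (b c : k) v :
    'Hom(string_space I v, string_space I' v) :=
  string_lfun I v (fun q =>
    (if compatible I I' then b else 0) *: unit_vec I' v q +
    (if q == 0%N then c else 0) *: unit_vec I' v N.-1).

Lemma string_hom_comm I I' b c (a : arrow U) :
  (string_hom_fun I I' b c (tgt a) \o rep_map (string I) a =
   rep_map (string I') a \o string_hom_fun I I' b c (src a))%VF.
Proof.
apply: unit_vec_ext => q vq; rewrite !comp_lfunE rep_map_unit //.
rewrite /string_hom_fun [in RHS]string_lfun_unit // string_lfun_unit_if.
have := @rep_map_unit_if I' a; set g := rep_map (string I') a => gE.
have gD x x' y y' : g (x *: y + x' *: y') = x *: g y + x' *: g y'.
  by rewrite linearD !linearZ.
rewrite gD !gE scalerDr {gD gE g}.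
have last0 : unit_vec I' (tgt a) (next_pos a N.-1) = 0 \/ ~~ at_vertex I' (src a) N.-1.
  have [vN|] := boolP (at_vertex I' (src a) N.-1); last by right.
  left; case/and3P: vN => N1N /eqP pE _.
  case: (out_arrowP hm hn N1N pE) => i -> /=; try lia.
    by rewrite /rightward; lia.
  by move=> _ _; apply: unit_vec_out; apply/negP=> /and3P[]; lia.
have {last0} -> : (at_vertex I' (src a) N.-1)%:R *:
    unit_vec I' (tgt a) (next_pos a N.-1) = 0.
  by case: last0 => [->|/negPf->]; rewrite ?scaler0 ?scale0r.
rewrite scaler0 addr0; case/and3P: vq => qN /eqP pE Iq.
have cond q' q'' (t : string_space I' (tgt a)) :
    (~~ at_vertex I' (tgt a) q' -> t = 0) -> (compatible I I' -> at_vertex I' (tgt a) q' ->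
      at_vertex I (tgt a) q' = at_vertex I' (src a) q'') ->
    (at_vertex I (tgt a) q')%:R *: ((if compatible I I' then b else 0) *: t) =
    (if compatible I I' then b else 0) *: ((at_vertex I' (src a) q'')%:R *: t).
  have [v'|_] := boolP (at_vertex I' (tgt a) q') => t0 E; last by rewrite t0 // !scaler0.
  move: E; case: (compatible I I') => [->|_] //; last by rewrite !scale0r scaler0.
  by rewrite !scalerA mulrC.
case: (out_arrowP hm hn qN pE) => i aE.
- move=> rq q1N pE1; have -> : next_pos a q = q.+1 by rewrite aE.
  have -> : (q.+1 == 0%N) = false by [].
  rewrite scale0r scaler0 addr0; apply: cond.
    exact: unit_vec_out.
  move=> /allP/(_ q); rewrite mem_iota rq Iq /= => /(_ _)/implyP compat.
  rewrite /at_vertex qN q1N pE pE1 !eqxx /= => I'q1.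
  by apply/eqP/compat => //; lia.
- move=> q0 rq pE1; have -> : next_pos a q = q.-1 by rewrite aE.
  have -> : (q.-1 == 0%N) = false by apply: contraNF rq => /eqP->.
  rewrite scale0r scaler0 addr0; apply: cond; first exact: unit_vec_out.
  move=> /allP/(_ q.-1); rewrite mem_iota (negPf rq) prednK // Iq /= => /(_ _)/implyP compat.
  have q1N : (q.-1 < N)%N by lia.
  rewrite /at_vertex qN q1N pE pE1 !eqxx /= => I'q1.
  by apply/eqP/compat => //; lia.
move=> qE pE1; have -> : next_pos a q = q.+1 by rewrite aE.
have -> : (q.+1 == 0%N) = false by [].
rewrite scale0r scaler0 addr0.
have -> : unit_vec I' (tgt a) q.+1 = 0.
  by apply: unit_vec_out; apply/negP=> /and3P[]; lia.
by rewrite !scaler0.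
Qed.

Definition string_hom I I' b c : rep_hom (string I) (string I') :=
  @RepHom _ _ (string I) (string I') (string_hom_fun I I' b c)
    (string_hom_comm I I' b c).

Lemma entry_string_hom I I' b c v q t : at_vertex I' v q ->
  entry I' v q (string_hom I I' b c v t) =
  (if compatible I I' then b else 0) * entry I v q t +
  (if q == N.-1 then c else 0) * entry I v 0 t.
Proof.
move=> vq'; rewrite /= string_lfunE linear_sum /=.
under eq_bigr => r _ do
  rewrite linearZ linearD !linearZ /= !entry_unit vq' /= scalerDr.
rewrite big_split /=; congr (_ + _).
  have qN : (q < N)%N by case/and3P: vq'.
  rewrite (bigD1 (Ordinal qN)) //= big1 ?addr0 => [|r neq].
    by rewrite eqxx [_ *: _]mulrC [_ *: _]mulr1.
  case: eqP => [qr|_]; last by rewrite !scaler0.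
  by case/eqP: neq; apply: val_inj.
have N0 : (0 < N)%N by lia.
rewrite (bigD1 (Ordinal N0)) //= big1 ?addr0 => [|r neq].
  by rewrite [_ *: _]mulrC; case: (q == _); rewrite ?scaler0 ?mul0r // [_ *: 1]mulr1.
have -> : (r == 0 :> nat) = false by apply: contraNF neq => /eqP r0; apply/eqP/val_inj.
by rewrite scale0r scaler0.
Qed.

(** A basis vector that is killed, or one that is not reached, prevents the
    morphism from splitting. The second summand spares position 0 in the source
    and position [N - 1] in the target, whence the two provisos. *)
Lemma string_hom_radical I I' b c q :
  (I.1 <= I.2 < N)%N -> (I'.1 <= I'.2 < N)%N -> (q < N)%N ->
  in_interval I q && ~~ in_interval I' q && ((q != 0%N) || (c == 0)) ||
  in_interval I' q && ~~ in_interval I q && ((q != N.-1) || (c == 0)) ->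
  radical (string_hom I I' b c).
Proof.
move=> /andP[I12 IN] /andP[I12' IN'] qN /orP[|] /andP[/andP[Iq Iq'] qc].
  apply: radical_of_not_split_mono; first exact: string_indecomposable.
  move=> [g gf]; have vq := at_vertex_pos qN Iq.
  have : entry I (pv q) q (hom_comp g (string_hom I I' b c) (pv q) (unit_vec I (pv q) q)) = 1.
    by rewrite gf id_lfunE entry_unit_diag.
  rewrite hom_compE /= string_lfun_unit //.
  have -> : unit_vec I' (pv q) q = 0.
    by apply: unit_vec_out; apply/negP=> /and3P[_ _]; apply/negP.
  have -> : (if q == 0%N then c else 0) = 0.
    by case: eqP qc => //= _ /eqP.
  by rewrite scaler0 scale0r addr0 !linear0 => /esym/eqP; rewrite oner_eq0.
apply: radical_of_not_split_epi; first exact: string_indecomposable.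
move=> [g fg]; have vq := at_vertex_pos qN Iq.
have : entry I' (pv q) q (hom_comp (string_hom I I' b c) g (pv q) (unit_vec I' (pv q) q)) = 1.
  by rewrite fg id_lfunE entry_unit_diag.
rewrite hom_compE entry_string_hom // entry_out; last by apply/negP=> /and3P[_ _]; apply/negP.
have -> : (if q == N.-1 then c else 0) = 0 by case: eqP qc => //= _ /eqP.
by rewrite mulr0 mul0r addr0 => /esym/eqP; rewrite oner_eq0.
Qed.

(** * Linked vectors and functionals as morphisms *)

Local Notation pos_space M := (fun q => rep_space M (pv q)).
Local Notation from_right M :=
  (@from_right k (pos_space M) rw (fun q => fw M q) (fun q => bw M q)).
Local Notation from_left M :=
  (@from_left k (pos_space M) rw (fun q => fw M q) (fun q => bw M q)).
Local Notation rep_linked M :=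
  (@linked k (pos_space M) rw (fun q => fw M q) (fun q => bw M q)).
Local Notation rep_colinked M :=
  (@colinked k (pos_space M) rw (fun q => fw M q) (fun q => bw M q)).

(** End conditions for vectors ([_end]) and for functionals ([_coend]): a
    vector must be killed by the arrow that leaves the string there, and a
    functional must vanish on the image of the arrow that enters it, if there is
    one. At position [N - 1] the leaving arrow is [gamma_m], at position 0 the
    entering one is [gamma_(m-1)]. *)
Definition right_end M q : {vspace M (pv q)} :=
  if q == N.-1 then lker (step M (pv q) (pv 1))
  else if rw q then lker (fw M q) else fullv.

Definition right_coend M q : {vspace M (pv q)} :=
  if rw q then 0%VS else limg (bw M q).

Definition left_end M q : {vspace M (pv q)} :=
  if q is q'.+1 return {vspace M (pv q)} then
    if rw q' then fullv else lker (bw M q')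
  else fullv.

Definition left_coend M q : {vspace M (pv q)} :=
  if q is q'.+1 return {vspace M (pv q)} then
    if rw q' then limg (fw M q') else 0%VS
  else limg (step M (pv N.-2) (pv 0)).

Lemma rep_map_transport M (a : arrow U) u (x : M u) (uE : u = src a) :
  rep_map M a (transport M u (src a) x) = step M u (tgt a) x.
Proof.
rewrite -step_rep_map; last exact: arrow_inj.
exact: step_transport.
Qed.

Lemma transport_rep_map M (a : arrow U) v (x : M (src a)) : tgt a = v ->
  transport M (tgt a) v (rep_map M a x) = step M (src a) v x.
Proof.
move=> vE; rewrite -step_rep_map; last exact: arrow_inj.
exact: transport_step.
Qed.

Lemma hom_from_string M i j (y : forall q, M (pv q)) :
  (j < N)%N ->
  (forall q, (i <= q < j)%N -> rep_linked M y q) ->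
  y i \in left_end M i -> y j \in right_end M j ->
  exists s : rep_hom (string (i, j)) M,
    forall q, (i <= q <= j)%N -> s (pv q) (unit_vec (i, j) (pv q) q) = y q.
Proof.
move=> jN link_y yi yj.
pose s v := string_lfun (i, j) v (fun q => transport M (pv q) v (y q)).
have s_comm (a : arrow U) :
    (s (tgt a) \o rep_map (string (i, j)) a = rep_map M a \o s (src a))%VF.
  apply: unit_vec_ext => q vq; rewrite !comp_lfunE rep_map_unit //.
  rewrite [in RHS]string_lfun_unit // string_lfun_unit_if; case/and3P: vq => qN /eqP pE Iq.
  rewrite [in RHS](_ : rep_map M a _ = step M (pv q) (tgt a) (y q)); last first.
    exact: rep_map_transport.
  case: (out_arrowP hm hn qN pE) => i' aE.
  - move=> rq q1N pE1; have -> : next_pos a q = q.+1 by rewrite aE.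
    have [vq1|] := boolP (at_vertex _ _ _).
      rewrite scale1r; case/and3P: vq1 => _ _ /andP[/= _ jq].
      have := link_y q; rewrite /linked rq => -> //; first exact: transport_step.
      by case/andP: Iq => /= -> _.
    rewrite (at_vertexE _ q1N pE1) => nI; rewrite scale0r.
    have qj : q = j by move: nI Iq; rewrite /in_interval /=; lia.
    move: yj; rewrite /right_end -qj rq; case: eqP => [?|_]; first by lia.
    by rewrite memv_ker -(transport_step _ pE1) => /eqP->; rewrite linear0.
  - move=> q0 rq pE1; have -> : next_pos a q = q.-1 by rewrite aE.
    case: q q0 rq pE1 qN pE Iq => // q _; rewrite succnK => rq pE1 qN pE Iq.
    have [vq1|] := boolP (at_vertex _ _ _).
      rewrite scale1r; case/and3P: vq1 => _ _ /andP[/= iq _].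
      have := link_y q; rewrite /linked (negPf rq) => -> //; first exact: transport_step.
      by rewrite iq; case/andP: Iq.
    rewrite (at_vertexE _ (ltnW qN) pE1) => nI; rewrite scale0r.
    have qi : q.+1 = i by move: nI Iq; rewrite /in_interval /=; lia.
    move: yi; rewrite /left_end -qi (negPf rq).
    by rewrite memv_ker -(transport_step _ pE1) => /eqP->; rewrite linear0.
  move=> qE pE1; have -> : at_vertex (i, j) (tgt a) (next_pos a q) = false.
    by rewrite aE /=; apply/negP=> /and3P[]; lia.
  have qj : q = j by move: Iq; rewrite /in_interval /=; lia.
  move: yj; rewrite /right_end -qj qE eqxx scale0r -qE.
  by rewrite memv_ker -(transport_step _ pE1) => /eqP->; rewrite linear0.
exists (@RepHom _ _ (string (i, j)) M s s_comm) => q Iq.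
rewrite /= string_lfun_unit; first exact: transport_refl.
by apply: at_vertex_pos => //; lia.
Qed.

Lemma hom_to_string M i j (phi : forall q, 'Hom(M (pv q), k^o)) :
  (j < N)%N ->
  (forall q, (i <= q < j)%N -> rep_colinked M phi q) ->
  (left_coend M i <= lker (phi i))%VS -> (right_coend M j <= lker (phi j))%VS ->
  exists r : rep_hom M (string (i, j)),
    forall q z, (i <= q <= j)%N -> entry (i, j) (pv q) q (r (pv q) z) = phi q z.
Proof.
move=> jN link_phi /subvP phi_i /subvP phi_j.
pose r v := (\sum_(q < N) (line (unit_vec (i, j) v q) \o (phi q \o transport M v (pv q))))%VF.
have entry_r v q z : at_vertex (i, j) v q ->
    entry (i, j) v q (r v z) = phi q (transport M v (pv q) z).
  move=> vq; rewrite sum_lfunE linear_sum /=.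
  have qN : (q < N)%N by case/and3P: vq.
  rewrite (bigD1 (Ordinal qN)) //= big1 ?addr0 => [|r' neq].
    by rewrite !comp_lfunE lineE linearZ /= entry_unit vq eqxx [_ *: _]mulr1.
  rewrite comp_lfunE lineE linearZ /= entry_unit vq; case: eqP => [qr|_].
    by case/eqP: neq; apply: val_inj.
  exact: mulr0.
have r_comm (a : arrow U) :
    (r (tgt a) \o rep_map M a = rep_map (string (i, j)) a \o r (src a))%VF.
  apply/lfunP=> z; rewrite !comp_lfunE; apply: entry_ext => q vq.
  rewrite entry_r //; case/and3P: (vq) => qN /eqP pE Iq.
  rewrite transport_rep_map // -step_rep_map; last exact: arrow_inj.
  case: (in_arrowP hm hn qN pE) => i' aE.
  - case: q qN pE Iq vq => // q qN pE Iq vq _; rewrite succnK => rq pE1.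
    have -> : entry (i, j) (tgt a) q.+1 (step (string (i, j)) (src a) (tgt a) (r (src a) z)) =
              entry (i, j) (src a) q (r (src a) z).
      move: (r (src a) z); rewrite -pE1 -pE => t; exact: entry_fw.
    rewrite -(step_transport _ _ (esym pE1)).
    have [vq1|nvq] := boolP (at_vertex (i, j) (src a) q).
      rewrite entry_r //; case/and3P: vq1 => _ _ /andP[/= iq _].
      have := link_phi q; rewrite /colinked rq => -> //; first by rewrite comp_lfunE.
      by rewrite iq; case/andP: Iq.
    rewrite entry_out //; move: nvq; rewrite (at_vertexE _ (ltnW qN) pE1) => nI.
    have qi : q.+1 = i by move: nI Iq; rewrite /in_interval /=; lia.
    move: phi_i; rewrite /left_coend -qi rq => phi_i.
    by apply/eqP; rewrite -memv_ker phi_i // memv_img ?memvf.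
  - move=> q1N rq pE1.
    have -> : entry (i, j) (tgt a) q (step (string (i, j)) (src a) (tgt a) (r (src a) z)) =
              entry (i, j) (src a) q.+1 (r (src a) z).
      move: (r (src a) z); rewrite -pE1 -pE => t; exact: entry_bw.
    rewrite -(step_transport _ _ (esym pE1)).
    have [vq1|nvq] := boolP (at_vertex (i, j) (src a) q.+1).
      rewrite entry_r //; case/and3P: vq1 => _ _ /andP[/= _ jq].
      have := link_phi q; rewrite /colinked (negPf rq) => -> //; first by rewrite comp_lfunE.
      by case/andP: Iq => /= -> _.
    rewrite entry_out //; move: nvq; rewrite (at_vertexE _ q1N pE1) => nI.
    have qj : q = j by move: nI Iq; rewrite /in_interval /=; lia.
    move: phi_j; rewrite /right_coend -qj (negPf rq) => phi_j.
    by apply/eqP; rewrite -memv_ker phi_j // memv_img ?memvf.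
  move=> q0 pE1; rewrite step_rep_map; last exact: arrow_inj.
  rewrite q0 in qN pE Iq vq *.
  rewrite -(step_transport _ _ (esym pE1)) [in RHS]string_lfunE linear_sum big1.
    have i0 : i = 0%N by move: Iq; rewrite /in_interval /=; lia.
    move: phi_i; rewrite i0 /= => phi_i.
    by apply/eqP; rewrite -memv_ker phi_i // memv_img ?memvf.
  move=> r' _; rewrite linearZ /= entry_unit.
  have -> : (0%N == next_pos a r') = false by rewrite aE.
  rewrite andbF; exact: mulr0.
exists (@RepHom _ _ M (string (i, j)) r r_comm) => q z Iq.
rewrite /= entry_r ?transport_refl //.
by apply: at_vertex_pos => //; lia.
Qed.

Lemma elem_from_string M i p j y : (i <= p <= j)%N -> (j < N)%N ->
  y \in from_left M (left_end M) (p - i) p ->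
  y \in from_right M (right_end M) (j - p) p ->
  exists s : rep_hom (string (i, j)) M, s (pv p) (unit_vec (i, j) (pv p) p) = y.
Proof.
move=> /andP[ip pj] jN /from_left_lift[]; first by lia.
move=> yl [ylp linkl endl] /from_right_lift[yr [yrp linkr endr]].
pose y' q := if (q <= p)%N then yl q else yr q.
have y'p : y' p = y by rewrite /y' leqnn.
have y'r q : (p <= q)%N -> y' q = yr q.
  by rewrite leq_eqVlt => /orP[/eqP<-|pq]; rewrite ?y'p // /y' leqNgt pq.
have y'l q : (q <= p)%N -> y' q = yl q by rewrite /y' => ->.
have [||| s sE] := @hom_from_string M i j y' jN.
- move=> q /andP[iq qj]; case: (leqP p q) => pq.
    by have := linkr q; rewrite /linked !y'r; [apply; lia | lia | lia].
  by have := linkl q; rewrite /linked !y'l; [apply; lia | lia | lia].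
- by rewrite y'l // endl //; lia.
- by rewrite y'r // endr //; lia.
by exists s; rewrite sE ?ip.
Qed.

(** A vector outside the sum is separated from it by a functional, which can
    be continued in both directions. *)
Lemma elem_to_string M i p j z : (i <= p <= j)%N -> (j < N)%N ->
  z \notin (from_left M (left_coend M) (p - i) p +
            from_right M (right_coend M) (j - p) p)%VS ->
  exists r : rep_hom M (string (i, j)), entry (i, j) (pv p) p (r (pv p) z) = 1.
Proof.
move=> /andP[ip pj] jN /separating_functional[phi].
rewrite subv_add => /andP[killl killr] phiz.
have [|phil [philp linkl endl]] := from_left_colift _ killl; first by lia.
have [phir [phirp linkr endr]] := from_right_colift killr.
pose phi' q := if (q <= p)%N then phil q else phir q.
have phi'p : phi' p = phi by rewrite /phi' leqnn.
have phi'r q : (p <= q)%N -> phi' q = phir q.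
  by rewrite leq_eqVlt => /orP[/eqP<-|pq]; rewrite ?phi'p // /phi' leqNgt pq.
have phi'l q : (q <= p)%N -> phi' q = phil q by rewrite /phi' => ->.
have [||| r rE] := @hom_to_string M i j phi' jN.
- move=> q /andP[iq qj]; case: (leqP p q) => pq.
    by have := linkr q; rewrite /colinked !phi'r; [apply; lia | lia | lia].
  by have := linkl q; rewrite /colinked !phi'l; [apply; lia | lia | lia].
- by rewrite phi'l // endl //; lia.
- by rewrite phi'r // endr //; lia.
by exists r; rewrite rE ?ip // phi'p.
Qed.

(** If the image of a basis vector lay outside the sum, it would be mapped
    back to the string module with coefficient 1. The radical morphism would
    then induce an injective endomorphism of an indecomposable module. *)
Lemma radical_shift X Y (f : rep_hom X Y) i p j (s : rep_hom (string (i, j)) X) :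
  (i <= p <= j)%N -> (j < N)%N -> radical f ->
  f (pv p) (s (pv p) (unit_vec (i, j) (pv p) p)) \in
    (from_left Y (left_coend Y) (p - i) p +
     from_right Y (right_coend Y) (j - p) p)%VS.
Proof.
move=> ipj jN radf; apply: contraT => /(elem_to_string ipj jN)[r rE].
exfalso; apply: (radical_not_injective (h := s) (h' := r) radf).
  by apply: string_indecomposable => //=; lia.
move=> v; apply: (@string_endo_inj (i, j) _ p) => //.
by rewrite !hom_compE rE oner_neq0.
Qed.

(** * Consecutive strings at a vertex *)

Lemma gamma_gamma0 M u v w (x : M u) :
  u = gamma_vertex m n.-1 m.-2 -> v = gamma_vertex m n.-1 m.-1 ->
  w = gamma_vertex m n.-1 m -> step M v w (step M u v x) = 0.
Proof.
have lt0 : (m.-2 < m)%N by lia.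
have lt1 : (m.-2.+1 < m)%N by lia.
have mE : m.-2.+2 = m by lia.
have mE1 : m.-1 = m.-2.+1 by lia.
have wE : gamma_vertex m n.-1 m = gamma_vertex m n.-1 m.-2.+2 by rewrite mE.
rewrite wE mE1 => uE vE wE'; subst u v w.
have := @rep_bound _ _ M _ _ _ (@U_rel_gamma m n.-1 m.-2 lt0 lt1 mE).
rewrite /= comp_lfun1l => /lfunP/(_ x); rewrite comp_lfunE zero_lfunE => <-.
have inj := @arrow_inj m n hm hn.
apply: etrans (@step_rep_map _ _ inj M (inl (Ordinal lt1)) _) _.
by congr (rep_map M _ _); apply: (@step_rep_map _ _ inj M (inl (Ordinal lt0))).
Qed.

Lemma pos_vertex_penultimate q : q.+1 = N.-1 -> pv q = gamma_vertex m n.-1 m.-2.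
Proof.
move=> qE; apply: (vertex_pos_inj hm hn).
by rewrite (vertex_pos_pos hm hn) ?(vertex_pos_gamma hm hn); [do 2 case: eqP|..]; lia.
Qed.

Lemma pos_vertex_one : pv 1 = gamma_vertex m n.-1 m.
Proof.
apply: (vertex_pos_inj hm hn).
by rewrite (vertex_pos_pos hm hn) ?(vertex_pos_gamma hm hn) ?eqxx //; lia.
Qed.

Lemma relation_last M q x : q.+1 = N.-1 -> step M (pv q.+1) (pv 1) (fw M q x) = 0.
Proof.
move=> qE; apply: gamma_gamma0; rewrite ?pos_vertex_one //.
  exact: pos_vertex_penultimate.
by rewrite qE pos_vertex_last.
Qed.

Lemma relation_first M x : fw M 0 (step M (pv N.-2) (pv 0) x) = 0.
Proof.
apply: gamma_gamma0; rewrite ?pos_vertex_one //.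
by apply: pos_vertex_penultimate; lia.
Qed.

Lemma from_right_full M d q x : (n <= q)%N -> (q + d.+1)%N = N.-1 ->
  x \in from_right M (right_end M) d.+1 q.
Proof.
elim: d q x => [|d IH] q x nq qd.
  rewrite /= /pull /rightward nq orbT -memv_preim /right_end.
  have -> : q.+1 == N.-1 by lia.
  by rewrite memv_ker relation_last //; lia.
rewrite [from_right _ _ _ _]/= /pull /rightward nq orbT -memv_preim.
by apply: IH; lia.
Qed.

(** The strings starting at position 0 are ordered by their right ends
    [1, 2, .., n - 1, N - 1, N - 2, .., n]. In this order, what the functionals of
    one string do not see is reached from the next one; this lemma and the next
    treat the step from [n - 1] to [N - 1] and the steps down from [N - 1]. *)
Lemma right_end_after_beta M p x : (p < n)%N ->
  x \in from_right M (right_coend M) (n.-1 - p) p ->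
  x \in from_right M (right_end M) (N.-1 - p) p.
Proof.
move=> pn; have [d dE] : exists d, m = d.+2 by exists m.-2; lia.
have -> : (N.-1 - p = n.-1 - p + d.+2)%N by lia.
rewrite -from_right_trans; apply/subvP/from_right_mono.
have -> : (p + (n.-1 - p) = n.-1)%N by lia.
apply/subvP=> z; rewrite /right_coend.
have -> : rw n.-1 = false by rewrite /rightward; lia.
move=> /memv_imgP[t _ ->].
rewrite [from_right _ _ _ _]/= /pull; have -> : rw n.-1 = false by rewrite /rightward; lia.
by rewrite memv_img //; apply: from_right_full; lia.
Qed.

Lemma right_end_before_gamma M p q x : (p <= q)%N -> (n <= q)%N -> (q < N.-1)%N ->
  x \in from_right M (right_coend M) (q.+1 - p) p ->
  x \in from_right M (right_end M) (q - p) p.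
Proof.
move=> pq nq qN; have -> : (q.+1 - p = q - p + 1)%N by lia.
rewrite -from_right_trans; apply/subvP/from_right_mono.
have -> : (p + (q - p) = q)%N by lia.
rewrite /= /pull /right_end /right_coend /rightward nq orbT (leqW nq) orbT.
by rewrite lpreim0 (ltn_eqF qN).
Qed.

Lemma right_coend_beta0 M d q x : (0 < q)%N -> (q + d)%N = n ->
  x \in from_right M (right_coend M) d q -> x = 0.
Proof.
elim: d q x => [|d IH] q x q0 qn.
  rewrite /= /right_coend /rightward; have -> : (n <= q)%N by lia.
  by rewrite orbT memv0 => /eqP.
rewrite /= /pull /rightward; have -> : (q == 0%N) || (n <= q)%N = false by lia.
by move=> /memv_imgP[y yin ->]; rewrite (IH _ _ _ _ yin) ?linear0 //; lia.
Qed.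

(** After the last string that starts with [gamma_m], only the kernel of
    [gamma_m] remains. *)
Lemma right_coend_kernel M d x : d = n ->
  x \in from_right M (right_coend M) d 0 -> fw M 0 x = 0.
Proof.
case: d => [|d] dn; first by lia.
rewrite [from_right _ _ _ _]/= /pull -memv_preim => /right_coend_beta0; apply; lia.
Qed.

Lemma left_coend_first M (A : forall q, {vspace M (pv q)}) d x :
  x \in left_coend M 0 -> x \in from_right M A d.+1 0.
Proof.
move=> /memv_imgP[y _ ->]; rewrite [from_right _ _ _ _]/= /pull -memv_preim.
by rewrite relation_first mem0v.
Qed.

Lemma from_left_transfer M (A A' : forall q, {vspace M (pv q)}) i i' q p x :
  (i <= q)%N -> (i' <= q)%N -> (q <= p)%N ->
  (forall y, y \in from_left M A (q - i) q -> y \in from_left M A' (q - i') q) ->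
  x \in from_left M A (p - i) p -> x \in from_left M A' (p - i') p.
Proof.
move=> iq i'q qp sub.
have -> : (p - i = p - q + (q - i))%N by lia.
have -> : (p - i' = p - q + (q - i'))%N by lia.
rewrite -!from_left_trans; [|lia|lia].
apply/subvP/from_left_mono; first by lia.
have -> : (p - (p - q) = q)%N by lia.
exact/subvP.
Qed.

(** The strings ending at position [N - 1] are ordered by their left ends
    [N - 1, .., n + 1, 1, 0, 2, .., n], with the same relation between neighbours.
    The order depends only on the edges to the left, so it is stated for an
    arbitrary base position [p]. *)
Lemma left_end_before_gamma M i p x : (n < i)%N -> (i < p)%N ->
  x \in from_left M (left_coend M) (p - i.+1) p ->
  x \in from_left M (left_end M) (p - i) p.
Proof.
move=> ni ip; apply: (@from_left_transfer _ _ _ _ _ i.+1) => // y.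
rewrite subnn subSnn /= /push /left_coend /rightward.
have -> : (i == 0%N) || (n <= i)%N by lia.
move=> yin; suff -> : left_end M i = fullv by [].
case: i ni {ip y yin} => // i ni; rewrite /left_end /rightward.
by have -> : (i == 0%N) || (n <= i)%N by lia.
Qed.

Lemma left_end_beta_full M q x : (0 < q)%N -> (q <= n)%N ->
  x \in from_left M (left_end M) q.-1 q.
Proof.
case: q x => // q x _ /=; elim: q x => [|q IH] x qn; first exact: memvf.
rewrite /= /push /rightward; have -> : (q.+1 == 0%N) || (n <= q.+1)%N = false by lia.
by rewrite -memv_preim; apply: IH; lia.
Qed.

Lemma left_end_after_gamma M q p x : q.+1 = n -> (q.+1 < p)%N ->
  x \in from_left M (left_coend M) (p - q.+2) p ->
  x \in from_left M (left_end M) (p - 1) p.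
Proof.
move=> qn np; apply: (@from_left_transfer _ _ _ _ _ q.+2) => // y.
have rq : rw q.+1 by rewrite /rightward; lia.
rewrite subnn subn1 [from_left _ _ 0 _]/= /left_coend rq.
move=> /memv_imgP[z _ ->]; rewrite [from_left _ _ _ _]/= /push rq.
apply: memv_img; apply: (@left_end_beta_full M q.+1); lia.
Qed.

Lemma left_end_one_zero M p x : (0 < p)%N ->
  x \in from_left M (left_coend M) (p - 1) p ->
  x \in from_left M (left_end M) (p - 0) p.
Proof. by move=> p0; apply: (@from_left_transfer _ _ _ _ _ 1). Qed.

Lemma left_coend_zero_one M x : x \in from_left M (left_coend M) 1 1 -> x = 0.
Proof.
rewrite /= /push /= => /memv_imgP[y /memv_imgP[z _ ->] ->].
exact: relation_first.
Qed.

Lemma left_end_zero_two M p x : (1 < p)%N ->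
  x \in from_left M (left_coend M) (p - 0) p ->
  x \in from_left M (left_end M) (p - 2) p.
Proof.
move=> p1; apply: (@from_left_transfer _ _ _ _ _ 2) => // y.
rewrite subnn [in X in _ -> X]/= /left_end.
rewrite [from_left _ _ _ _]/= /push.
have -> : rw 1 = false by rewrite /rightward; lia.
by rewrite -memv_preim memv_ker => /left_coend_zero_one->.
Qed.

Lemma left_end_beta_succ M i p x : (1 < i < n)%N -> (i < p)%N ->
  x \in from_left M (left_coend M) (p - i) p ->
  x \in from_left M (left_end M) (p - i.+1) p.
Proof.
case: i => // i iin ip; apply: (@from_left_transfer _ _ _ _ _ i.+2) => // y.
rewrite subnn subSnn /= /push /left_end /left_coend.
have -> : rw i = false by rewrite /rightward; lia.
have -> : rw i.+1 = false by rewrite /rightward; lia.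
by rewrite lpreim0.
Qed.

Lemma left_coend_beta0 M i x : (1 < i <= n)%N -> x \in left_coend M i -> x = 0.
Proof.
case: i x => // i x iin; rewrite /left_coend.
have -> : rw i = false by rewrite /rightward; lia.
by rewrite memv0 => /eqP.
Qed.

Lemma left_coend_gamma0 M d p x : (n + d)%N = p ->
  x \in from_left M (left_coend M) d p -> x = 0.
Proof.
elim: d p x => [|d IH] p x.
  by rewrite from_left0 addn0 => np; apply: left_coend_beta0; lia.
case: p x => [|p] x np; first by lia.
rewrite /= /push /rightward; have -> : (p == 0%N) || (n <= p)%N by lia.
by move=> /memv_imgP[y yin ->]; rewrite (IH _ _ _ yin) ?linear0 //; lia.
Qed.

Lemma left_coend_last M d q x : q = N.-1 ->
  x \in from_left M (left_coend M) d q -> step M (pv q) (pv 1) x = 0.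
Proof.
case: q x => [|q] x qN; first by lia.
have rq : rw q by rewrite /rightward; lia.
suff sub : (from_left M (left_coend M) d q.+1 <= limg (fw M q))%VS.
  by move=> /(subvP sub)/memv_imgP[y _ ->]; rewrite relation_last.
by case: d => [|d]; rewrite /= ?/push rq // limgS ?subvf.
Qed.

(** * The strings starting at the last vertex of the gamma path *)

Definition right_seq d := if d == 0%N then n.-1 else (N - d)%N.

Definition left_seq d :=
  if (d < 2 * m)%N then (N + m - d)%N
  else if d == (2 * m)%N then 1%N
  else if d == (2 * m).+1 then 0%N
  else (d - 2 * m)%N.

(** The strings from [[0, n - 1]] on that start or end at [a_m]: first those
    based at position 0, then those based at position [N - 1]. They are linearly
    ordered, and [[0, N - 1]] occurs twice, at steps 1 and [2 m + 1], with its two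
    different basis vectors over [a_m]. *)
Definition depth_interval d :=
  if (d <= m)%N then (0%N, right_seq d) else (left_seq d, N.-1).

Definition base_pos d := if (d <= m)%N then 0%N else N.-1.

(** The [d]-th step of the filtration at [a_m], which becomes zero after the
    last string. *)
Definition reached d M (y : M (pv 0)) : Prop :=
  if (d <= n + 2 * m)%N then
    exists s : rep_hom (string (depth_interval d)) M,
      s (pv 0) (unit_vec (depth_interval d) (pv 0) (base_pos d)) = y
  else y = 0.

Lemma radical_shift_at X Y (f : rep_hom X Y) i p j v (s : rep_hom (string (i, j)) X) :
  v = pv p -> (i <= p <= j)%N -> (j < N)%N -> radical f ->
  transport Y v (pv p) (f v (s v (unit_vec (i, j) v p))) \in
    (from_left Y (left_coend Y) (p - i) p +
     from_right Y (right_coend Y) (j - p) p)%VS.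
Proof. by move=> vE; subst v; rewrite transport_refl; apply: radical_shift. Qed.

Lemma elem_from_string_at M i p j v y : v = pv p -> (i <= p <= j)%N -> (j < N)%N ->
  transport M v (pv p) y \in from_left M (left_end M) (p - i) p ->
  transport M v (pv p) y \in from_right M (right_end M) (j - p) p ->
  exists s : rep_hom (string (i, j)) M, s v (unit_vec (i, j) v p) = y.
Proof. by move=> vE; subst v; rewrite transport_refl; apply: elem_from_string. Qed.

Lemma left_seq_succ M d x : (m < d < n + 2 * m)%N ->
  x \in from_left M (left_coend M) (N.-1 - left_seq d) N.-1 ->
  x \in from_left M (left_end M) (N.-1 - left_seq d.+1) N.-1.
Proof.
move=> dm; rewrite /left_seq.
have [d1|d1] := ltnP d.+1 (2 * m).
  rewrite (ltnW d1); have -> : (N + m - d = (N + m - d.+1).+1)%N by lia.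
  by apply: left_end_before_gamma; lia.
have [d2|d2] := ltnP d (2 * m).
  have -> : d.+1 == (2 * m)%N by lia.
  have -> : (N + m - d = n.-1.+2)%N by lia.
  by apply: left_end_after_gamma; lia.
have -> : (d.+1 == 2 * m)%N = false by lia.
have [->|d3] := eqVneq d (2 * m)%N.
  by rewrite eqxx; apply: left_end_one_zero; lia.
have -> : (d.+1 == (2 * m).+1)%N = false by lia.
have [->|d4] := eqVneq d (2 * m).+1.
  have -> : ((2 * m).+2 - 2 * m = 2)%N by lia.
  by apply: left_end_zero_two => //; lia.
have -> : (d.+1 - 2 * m = (d - 2 * m).+1)%N by lia.
by apply: left_end_beta_succ => //; lia.
Qed.

Lemma left_seq_bound d : (m < d <= n + 2 * m)%N -> (left_seq d < N)%N.
Proof. by rewrite /left_seq => dm; do ?[case: ifP => ?]; lia. Qed.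

(** What a radical morphism does to the base vector of one string is bounded
    by the functionals of that string, hence is reached from the next one. At
    [d = m] the base position jumps from 0 to [N - 1]: the kernel of [gamma_m] is
    where the strings of the second kind begin. *)
Lemma reached_shift X Y (f : rep_hom X Y) d x : (d < n + 2 * m + 1)%N ->
  radical f -> reached d x -> reached d.+1 (f (pv 0) x).
Proof.
move=> dK radf; rewrite {1}/reached; have -> : (d <= n + 2 * m)%N by lia.
have last_pos : pv 0 = pv N.-1 by rewrite pos_vertex_last.
rewrite /depth_interval /base_pos /right_seq; case: leqP => dm [s <-] {x}.
  set j := (if _ then _ else _) in s *.
  have jP : (0 < j < N)%N by rewrite /j; case: ifP; lia.
  set y := f _ _.
  have yin : y \in from_right Y (right_coend Y) j 0.
    have := @radical_shift_at _ _ f 0 0 j _ s erefl.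
    rewrite transport_refl subn0 -/y => /(_ isT (proj2 (andP jP)) radf).
    case/memv_addP=> u uin [w win ->]; rewrite subn0 in win; apply: memvD => //.
    by case: (j) jP => // j' _; apply: left_coend_first.
  rewrite /reached; have -> : (d.+1 <= n + 2 * m)%N by lia.
  have [dm1|dm1] := eqVneq d m.
    have jn : j = n by rewrite /j; case: ifP; lia.
    rewrite /depth_interval /base_pos dm1 ltnn.
    have lE : left_seq m.+1 = N.-1 by rewrite /left_seq ifT; lia.
    rewrite lE; apply: elem_from_string_at => //; try lia.
      rewrite subnn; have -> : N.-1 = N.-2.+1 by lia.
      rewrite /= /left_end.
      have -> : rw N.-2 by rewrite /rightward; lia.
      exact: memvf.
    rewrite subnn /= /right_end eqxx memv_ker step_transport //.
    by rewrite (right_coend_kernel jn yin).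
  have -> : depth_interval d.+1 = (0, N - d.+1)%N by rewrite /depth_interval ifT //; lia.
  have -> : base_pos d.+1 = 0%N by rewrite /base_pos ifT //; lia.
  apply: elem_from_string_at => //; try lia; rewrite transport_refl; first exact: memvf.
  move: yin; rewrite /j; have [->|d0] := eqVneq d 0%N => yin.
    have -> : (N - 1 - 0 = N.-1 - 0)%N by lia.
    by apply: right_end_after_beta; rewrite ?subn0 //; lia.
  apply: right_end_before_gamma; try lia.
  by have -> : ((N - d.+1).+1 - 0 = N - d)%N by lia.
have dm2 : (m < d <= n + 2 * m)%N by lia.
have lN := left_seq_bound dm2.
set y := f _ _.
have yin : transport Y (pv 0) (pv N.-1) y \in
    from_left Y (left_coend Y) (N.-1 - left_seq d) N.-1.
  have := @radical_shift_at _ _ f (left_seq d) N.-1 N.-1 _ s last_pos.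
  have lN' : (left_seq d <= N.-1 <= N.-1)%N by lia.
  have NN : (N.-1 < N)%N by lia.
  rewrite subnn -/y => /(_ lN' NN radf).
  rewrite /= /right_coend; have -> : rw N.-1 by rewrite /rightward; lia.
  by rewrite addv0.
rewrite /reached /depth_interval /base_pos; have -> : (d.+1 <= m)%N = false by lia.
case: ltnP => [dn|dn].
  apply: elem_from_string_at => //; first 1 last.
  - by lia.
  - by apply: left_seq_succ => //; lia.
  - rewrite subnn /= /right_end eqxx memv_ker; apply/eqP.
    exact: left_coend_last yin.
  by have := @left_seq_bound d.+1; lia.
have -> : y = transport Y (pv N.-1) (pv 0) (transport Y (pv 0) (pv N.-1) y).
  by rewrite transport_trans // transport_refl.
have lE : left_seq d = n by rewrite /left_seq; do ?[case: ifP => ?]; lia.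
have lE' : (n + (N.-1 - left_seq d) = N.-1)%N by lia.
by rewrite (left_coend_gamma0 lE' yin) linear0.
Qed.

(** Between consecutive strings there is an inclusion or a projection, except
    at [d = m], where the step is the passage through the simple module at
    [a_m]. *)
Definition depth_hom d : rep_hom (string (depth_interval d)) (string (depth_interval d.+1)) :=
  string_hom (depth_interval d) (depth_interval d.+1)
    (if d == m then 0 else 1) (if d == m then 1 else 0).

Lemma depth_interval_bound d : (d <= n + 2 * m)%N ->
  ((depth_interval d).1 <= (depth_interval d).2 < N)%N.
Proof.
rewrite /depth_interval /right_seq /left_seq => dK.
by do ?[case: ifP => ?]; rewrite /=; lia.
Qed.

Lemma depth_hom_radical d : (d < n + 2 * m)%N -> radical (depth_hom d).
Proof.
move=> dK; pose q := if d == 0%N then n else if (d < m)%N then (N - d)%N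
  else if d == m then 1%N else if (d.+1 < 2 * m)%N then (N + m - d.+1)%N
  else if (d < 2 * m)%N then 1%N else if (d <= (2 * m).+1)%N then 0%N
  else (d - 2 * m)%N.
(* [q] is the position that distinguishes two consecutive intervals *)
apply: (@string_hom_radical _ _ _ _ q).
- by apply: depth_interval_bound; lia.
- by apply: depth_interval_bound; lia.
- by rewrite /q; do ?[case: ifP => ?]; lia.
have -> : ((if d == m then 1 else 0 : k) == 0) = (d != m).
  by case: (d == m); rewrite ?eqxx ?oner_eq0.
rewrite /q /in_interval /depth_interval /right_seq /left_seq.
by do ?[case: ifP => ?]; rewrite /=; lia.
Qed.

Lemma depth_compatible d : (d < n + 2 * m)%N -> d != m ->
  compatible (depth_interval d) (depth_interval d.+1).
Proof.
move=> dK dm; apply/allP => q; rewrite mem_iota => qN.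
rewrite /rightward /in_interval /depth_interval /right_seq /left_seq.
by do ?[case: ifP => ?]; rewrite /=; lia.
Qed.

(** Up to step [m] the basis vector at position 0 survives, which is all that
    the passage through [a_m] sees. *)
Lemma depth_chain_first l v t : (l <= m)%N ->
  entry (depth_interval (l + 0)) v 0 (hom_chain depth_hom 0 l v t) =
  entry (depth_interval 0) v 0 t.
Proof.
elim: l => [|l IH] lm; first by rewrite /= id_lfunE.
have at0 d : (d <= m)%N -> at_vertex (depth_interval d) v 0 = (pv 0 == v).
  move=> dm; rewrite /at_vertex /depth_interval dm /in_interval /= andbT.
  by have -> : (0 < N)%N by lia.
have [v0|v0] := boolP (pv 0 == v); last by rewrite !entry_out ?at0 //; lia.
rewrite [hom_chain _ _ _]/= hom_compE [LHS]entry_string_hom; last by rewrite at0 //; lia.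
have lm' : (l + 0 == m)%N = false by lia.
have -> : (0%N == N.-1) = false by lia.
rewrite lm' depth_compatible ?lm' //; last by lia.
by rewrite mul1r mul0r addr0 IH //; lia.
Qed.

Lemma depth_chain_last l v t q : (m < l <= n + 2 * m)%N ->
  at_vertex (depth_interval (l + 0)) v q ->
  entry (depth_interval (l + 0)) v q (hom_chain depth_hom 0 l v t) =
  if q == N.-1 then entry (depth_interval 0) v 0 t else 0.
Proof.
elim: l q => [|l IH] q; first by lia.
move=> lm vq; rewrite [hom_chain _ _ _]/= hom_compE [LHS]entry_string_hom //.
(* the first step beyond [m] is the passage through [a_m] *)
have [lE|lm'] := eqVneq (l + 0)%N m.
  rewrite depth_chain_first; last by lia.
  by rewrite if_same mul0r add0r; case: eqP; rewrite ?mul1r ?mul0r.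
rewrite depth_compatible //; last by lia.
rewrite if_same mul1r mul0r addr0.
have lm2 : (m < l <= n + 2 * m)%N by lia.
have [vq'|nvq'] := boolP (at_vertex (depth_interval (l + 0)) v q); first exact: IH.
rewrite entry_out //; case: eqP => // qN; case/negP: nvq'.
case/and3P: vq => qN' pE _; rewrite /at_vertex qN' pE qN /in_interval /depth_interval.
have -> : (l + 0 <= m)%N = false by lia.
have := @left_seq_bound (l + 0)%N; rewrite /=; lia.
Qed.

Lemma rad_comp_twist I I' (f : rep_hom (string I) (string I')) :
  I = depth_interval 0 -> I' = depth_interval (n + 2 * m) ->
  (forall v t q, at_vertex I' v q ->
     entry I' v q (f v t) = if q == N.-1 then entry I v 0 t else 0) ->
  rad_comp (n + 2 * m) f.
Proof.
rewrite -[(n + 2 * m)%N in X in _ -> X -> _]addn0 => IE IE'; subst I I' => fE.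
apply: (@rad_comp_eq _ _ _ _ _ (hom_chain depth_hom 0 (n + 2 * m))).
  move=> v; apply/lfunP=> t; apply: entry_ext => q vq.
  by rewrite fE // depth_chain_last //; lia.
have -> : rad_comp (n + 2 * m) = rad_comp (\sum_(0 <= j < n + 2 * m + 0) 1)
    :> (forall X Y, rep_hom X Y -> Prop).
  by rewrite addn0 sum_nat_const_nat subn0 muln1.
by apply: rad_comp_chain => [|j jin]; [lia | split=> //; apply: depth_hom_radical; lia].
Qed.

(** * The strings through the second vertex of the beta path *)

Lemma left_end_natural X Y (f : rep_hom X Y) q x :
  x \in left_end X q -> f (pv q) x \in left_end Y q.
Proof.
case: q x => [|q] x /=; first by rewrite !memvf.
case: (rw q); first by rewrite !memvf.
by rewrite !memv_ker -step_natural => /eqP->; rewrite linear0.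
Qed.

Lemma right_end_natural X Y (f : rep_hom X Y) q x :
  x \in right_end X q -> f (pv q) x \in right_end Y q.
Proof.
rewrite /right_end; do ?[case: ifP => _]; rewrite ?memvf //;
  by rewrite !memv_ker -step_natural => /eqP->; rewrite linear0.
Qed.

Lemma right_coend_natural X Y (f : rep_hom X Y) q x :
  x \in right_coend X q -> f (pv q) x \in right_coend Y q.
Proof.
rewrite /right_coend; case: ifP => _; first by rewrite !memv0 => /eqP->; rewrite linear0.
by move=> /memv_imgP[y _ ->]; rewrite step_natural memv_img ?memvf.
Qed.

Lemma left_coend_sub M q : (left_coend M q <= left_end M q)%VS.
Proof. by case: q => [|q] /=; [|case: (rw q)]; rewrite ?subvf ?sub0v. Qed.

Lemma right_coend_sub M q : (right_coend M q <= right_end M q)%VS.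
Proof.
rewrite /right_coend /right_end; case: (boolP (rw q)) => rq; first exact: sub0v.
have -> : (q == N.-1) = false by apply: contraNF rq => /eqP->; rewrite /rightward; lia.
exact: subvf.
Qed.

(** At position [n - 1] the left ends [0, 2, 3, .., n - 1] are numbered from 1;
    the end 1, which comes before them, is left out because the start of the
    chain already extends to position 0. *)
Definition grid_left d := if d == 1%N then 0%N else d.

Definition grid_left_end d M : {vspace M (pv n.-1)} :=
  if (0 < d < n)%N then from_left M (left_end M) (n.-1 - grid_left d) n.-1 else 0%VS.

Definition grid_right_end M : {vspace M (pv n.-1)} :=
  from_right M (right_end M) (N.-1 - n.-1) n.-1.

Definition grid_right_coend M : {vspace M (pv n.-1)} :=
  from_right M (right_coend M) (N.-1 - n.-1) n.-1.

(** Strings through position [n - 1] vary at both ends, so the filtration is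
    indexed by the sum of the two numbers. On the right only the ends [n - 1] and
    [N - 1] matter, and everything beyond is collected in [grid_right_coend]. *)
Definition grid d M : {vspace M (pv n.-1)} :=
  (grid_left_end d M + (grid_left_end d.-1 M :&: grid_right_end M) +
   grid_right_coend M)%VS.

Lemma grid_left_natural X Y (f : rep_hom X Y) d x :
  x \in grid_left_end d X -> f (pv n.-1) x \in grid_left_end d Y.
Proof.
rewrite /grid_left_end; case: ifP => _; last by rewrite !memv0 => /eqP->; rewrite linear0.
apply: (@from_left_natural _ _ _ _ _ _ _ _ (fun q => f (pv q))) => q z.
- exact: step_natural.
- exact: step_natural.
exact: left_end_natural.
Qed.

Lemma grid_right_natural X Y (f : rep_hom X Y) x :
  x \in grid_right_end X -> f (pv n.-1) x \in grid_right_end Y.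
Proof.
apply: (@from_right_natural _ _ _ _ _ _ _ _ (fun q => f (pv q))) => q z.
- exact: step_natural.
- exact: step_natural.
exact: right_end_natural.
Qed.

Lemma grid_right_coend_natural X Y (f : rep_hom X Y) x :
  x \in grid_right_coend X -> f (pv n.-1) x \in grid_right_coend Y.
Proof.
apply: (@from_right_natural _ _ _ _ _ _ _ _ (fun q => f (pv q))) => q z.
- exact: step_natural.
- exact: step_natural.
exact: right_coend_natural.
Qed.

Lemma grid_right_coend_sub M : (grid_right_coend M <= grid_right_end M)%VS.
Proof. by apply: from_right_mono; apply: right_coend_sub. Qed.

Lemma grid_left_bound d : (0 < d < n)%N -> (grid_left d <= n.-1)%N.
Proof. by rewrite /grid_left; case: ifP; lia. Qed.

Lemma grid_left_sub M d x : (0 < d < n)%N ->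
  x \in from_left M (left_coend M) (n.-1 - grid_left d) n.-1 ->
  x \in grid_left_end d M.
Proof.
move=> dn; rewrite /grid_left_end dn; apply/subvP/from_left_mono; first lia.
exact: left_coend_sub.
Qed.

Lemma grid_left_succ M d x : (0 < d < n)%N ->
  x \in from_left M (left_coend M) (n.-1 - grid_left d) n.-1 ->
  x \in grid_left_end d.+1 M.
Proof.
move=> dn; rewrite /grid_left_end [(0 < d.+1)%N]/= /grid_left.
have [->|d1] := eqVneq d 1%N.
  have -> : (2 == 1)%N = false by [].
  case: (ltnP 2 n) => n2.
    by apply: left_end_zero_two => //; lia.
  have zero q (y : M (pv q)) : q = 1%N ->
      y \in from_left M (left_coend M) (q - 0) q -> y = 0.
    by move=> q1; subst q; apply: left_coend_zero_one.
  by rewrite andbF => /zero->; rewrite ?mem0v //; lia.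
have -> : (d.+1 == 1)%N = false by lia.
case: (ltnP d.+1 n) => dn1; first by apply: left_end_beta_succ => //; lia.
have -> : d = n.-1 by lia.
by rewrite subnn from_left0 => /left_coend_beta0->; rewrite ?mem0v //; lia.
Qed.

(** A radical morphism sends a vector that belongs to one left and one right
    subspace into the same intersection and also into the sum of the two next
    subspaces. By the modular law the image splits into two parts, each of which
    has moved one step in one of the two directions. *)
Lemma grid_shift X Y (f : rep_hom X Y) d x : (0 < d)%N -> radical f ->
  x \in grid d X -> f (pv n.-1) x \in grid d.+1 Y.
Proof.
move=> d0 radf /memv_addP[_ /memv_addP[a a_in [b b_in ->]] [c c_in ->]].
rewrite !linearD /=; apply: memvD; first apply: memvD.
- have [dn|dn] := boolP (0 < d < n)%N; last first.
    move: a_in; rewrite /grid_left_end (negPf dn) memv0 => /eqP->.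
    by rewrite linear0 mem0v.
  have bound := grid_left_bound dn.
  have [||||s sE] := @elem_from_string X (grid_left d) n.-1 n.-1 a.
  + by rewrite bound leqnn.
  + by lia.
  + by move: a_in; rewrite /grid_left_end dn.
  + rewrite subnn /= /right_end /rightward.
    have -> : (n.-1 == N.-1) = false by lia.
    have -> : (n.-1 == 0%N) || (n <= n.-1)%N = false by lia.
    exact: memvf.
  have /memv_addP[w w_in [z z_in faE]] : f (pv n.-1) a \in
      (from_left Y (left_coend Y) (n.-1 - grid_left d) n.-1 +
       from_right Y (right_coend Y) (n.-1 - n.-1) n.-1)%VS.
    by rewrite -sE; apply: radical_shift; rewrite ?bound //; lia.
  rewrite faE; apply: memvD; first last.
    apply: (subvP (addvSl _ _)); apply: (subvP (addvSr _ _)).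
    rewrite memv_cap; apply/andP; split; last first.
      by apply: right_end_after_beta => //; lia.
    have -> : z = f (pv n.-1) a - w by rewrite faE addrC addKr.
    by apply: memvB; [apply: grid_left_natural | apply: grid_left_sub].
  by apply: (subvP (addvSl _ _)); apply: (subvP (addvSl _ _)); apply: grid_left_succ.
- have [dn|dn] := boolP (0 < d.-1 < n)%N; last first.
    move: b_in; rewrite /grid_left_end (negPf dn) cap0v memv0 => /eqP->.
    by rewrite linear0 mem0v.
  have bound := grid_left_bound dn.
  case/memv_capP: (b_in) => bl br.
  have [||||s sE] := @elem_from_string X (grid_left d.-1) n.-1 N.-1 b.
  + by rewrite bound; lia.
  + by lia.
  + by move: bl; rewrite /grid_left_end dn.
  + by [].
  have /memv_addP[w w_in [z z_in fbE]] : f (pv n.-1) b \in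
      (from_left Y (left_coend Y) (n.-1 - grid_left d.-1) n.-1 + grid_right_coend Y)%VS.
    by rewrite -sE; apply: radical_shift; rewrite ?bound //; lia.
  rewrite fbE; apply: memvD; last by apply: (subvP (addvSr _ _)).
  apply: (subvP (addvSl _ _)); apply: (subvP (addvSr _ _)).
  rewrite memv_cap; apply/andP; split.
    by have := grid_left_succ dn w_in; rewrite prednK.
  have -> : w = f (pv n.-1) b - z by rewrite fbE addrK.
  apply: memvB; first exact: grid_right_natural.
  exact: (subvP (grid_right_coend_sub Y)).
by apply: (subvP (addvSr _ _)); apply: grid_right_coend_natural.
Qed.

Lemma grid_final M x : x \in grid n.+1 M -> x \in grid_right_coend M.
Proof.
rewrite /grid /grid_left_end ltnn andbF; have -> : (n.+1 < n)%N = false by lia.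
by rewrite andbF cap0v !add0v.
Qed.

Lemma string_linked I q : (q.+1 < N)%N -> in_interval I q -> in_interval I q.+1 ->
  rep_linked (string I) (fun q => unit_vec I (pv q) q) q.
Proof.
move=> qN Iq Iq1; rewrite /linked; have [rq|rq] := boolP (rw q).
  by rewrite fw_unit.
by rewrite bw_unit.
Qed.

Lemma string_colinked I q : (q.+1 < N)%N -> in_interval I q -> in_interval I q.+1 ->
  rep_colinked (string I) (fun q => entry I (pv q) q) q.
Proof.
move=> qN Iq Iq1; rewrite /colinked; have [rq|rq] := boolP (rw q).
  by apply/lfunP=> t; rewrite comp_lfunE entry_fw.
by apply/lfunP=> t; rewrite comp_lfunE entry_bw.
Qed.

Lemma grid_start j : (n.-1 <= j < N)%N ->
  unit_vec (0%N, j) (pv n.-1) n.-1 \in grid 1 (string (0%N, j)).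
Proof.
move=> jN; do 2 apply: (subvP (addvSl _ _)).
rewrite /grid_left_end hn /= subn0.
apply: (@linked_from_left _ _ _ _ _ _ (fun q => unit_vec (0%N, j) (pv q) q)) => //.
  by move=> q qin; apply: string_linked; rewrite /in_interval /=; lia.
by rewrite subnn memvf.
Qed.

Lemma grid_right_coend_string I (t : string I (pv n.-1)) :
  (I.1 <= n.-1)%N -> I.2 = N.-1 ->
  t \in grid_right_coend (string I) -> entry I (pv n.-1) n.-1 t = 0.
Proof.
move=> I1 I2 tin; apply/eqP; rewrite -memv_ker; apply: subvP tin.
apply: (@colinked_from_right _ _ _ _ _ _ (fun q => entry I (pv q) q)).
  by move=> q qin; apply: string_colinked; rewrite /in_interval ?I2; lia.
rewrite /right_coend; have -> : rw (n.-1 + (N.-1 - n.-1))%N by rewrite /rightward; lia.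
exact: sub0v.
Qed.

(** * The chain of irreducible morphisms *)

(** The short exact sequence of [[0, n - 1]], [[0, N - 1]] and [[n, N - 1]], with
    the projection decomposed into [n - 1] steps. *)
Definition chain_interval i : nat * nat :=
  if (i <= 1)%N then (0%N, n.-1)
  else if i == 2%N then (0%N, N.-1)
  else (i.-1, N.-1).

Definition chain_rep i : rep k U := string (chain_interval i).

(** The inclusion is perturbed by the passage through the simple module at
    [a_m]. Without it the whole composition would vanish; with it, the depth of
    the shorter compositions does not change. *)
Definition chain_hom i : rep_hom (chain_rep i) (chain_rep i.+1) :=
  string_hom (chain_interval i) (chain_interval i.+1) 1 (if i == 1%N then 1 else 0).

Lemma chain_interval_bound i : (i <= n.+1)%N ->
  ((chain_interval i).1 <= (chain_interval i).2 < N)%N.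
Proof. by rewrite /chain_interval => iN; do ?[case: ifP => ?]; rewrite /=; lia. Qed.

Lemma chain_indecomposable i : (i <= n.+1)%N -> indecomposable (chain_rep i).
Proof. by move=> /chain_interval_bound/andP[? ?]; apply: string_indecomposable. Qed.

Lemma chain_radical i : (1 <= i <= n)%N -> radical (chain_hom i).
Proof.
move=> iN; pose q := if i == 1%N then n else if i == 2%N then 0%N else i.-1.
apply: (@string_hom_radical _ _ _ _ q).
- by apply: chain_interval_bound; lia.
- by apply: chain_interval_bound; lia.
- by rewrite /q; do ?[case: ifP => ?]; lia.
have -> : ((if i == 1%N then 1 else 0 : k) == 0) = (i != 1%N).
  by case: (i == 1%N); rewrite ?eqxx ?oner_eq0.
rewrite /q /in_interval /chain_interval.
by do ?[case: ifP => ?]; rewrite /=; lia.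
Qed.

Lemma chain_compatible i : (1 <= i <= n)%N ->
  compatible (chain_interval i) (chain_interval i.+1).
Proof.
move=> iN; apply/allP => q; rewrite mem_iota => qN.
rewrite /rightward /in_interval /chain_interval.
by do ?[case: ifP => ?]; rewrite /=; lia.
Qed.

Lemma chain_entry_from1 l v t q : (0 < l <= n)%N ->
  at_vertex (chain_interval (l + 1)) v q ->
  entry (chain_interval (l + 1)) v q (hom_chain chain_hom 1 l v t) =
  entry (chain_interval 1) v q t +
  if q == N.-1 then entry (chain_interval 1) v 0 t else 0.
Proof.
elim: l q => // l IH q lN vq; rewrite [hom_chain _ _ _]/= hom_compE [LHS]entry_string_hom //.
rewrite chain_compatible ?mul1r; last by lia.
case: l IH lN vq => [|l] IH lN vq.
  by rewrite /= id_lfunE; case: (q == _); rewrite ?mul1r ?mul0r.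
have -> : (l.+1 + 1 == 1)%N = false by lia.
rewrite if_same mul0r addr0 IH //; first by lia.
case/and3P: vq => qN pE; rewrite /at_vertex qN pE /in_interval /chain_interval.
by do ?[case: ifP => ?]; rewrite /=; lia.
Qed.

Lemma chain_entry_from2 l v t q : (l < n)%N ->
  at_vertex (chain_interval (l + 2)) v q ->
  entry (chain_interval (l + 2)) v q (hom_chain chain_hom 2 l v t) =
  entry (chain_interval 2) v q t.
Proof.
elim: l q => [|l IH] q lN vq; first by rewrite /= id_lfunE.
rewrite [hom_chain _ _ _]/= hom_compE [LHS]entry_string_hom //.
rewrite chain_compatible ?mul1r; last by lia.
have -> : (l + 2 == 1)%N = false by lia.
rewrite if_same mul0r addr0 IH //; first by lia.
case/and3P: vq => qN pE; rewrite /at_vertex qN pE /in_interval /chain_interval.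
by do ?[case: ifP => ?]; rewrite /=; lia.
Qed.

Lemma rad_pow_reached l d X Y (f : rep_hom X Y) x :
  (0 < l)%N -> (d + l = n + 2 * m + 1)%N -> rad_pow l f ->
  reached d x -> f (pv 0) x = 0.
Proof.
move=> l0 dl [r [g [rg fE]]] dx; rewrite fE sum_lfunE big1 // => i _.
have := @rad_comp_shift _ _ (pv 0) (fun d M => @reached d M) (n + 2 * m + 1)%N.
move=> /(_ (fun d X Y f x => @reached_shift X Y f d x)).
move=> /(_ l d X Y (g i) x l0 _ (rg i) dx); rewrite dl => /(_ (leqnn _)).
by rewrite /reached; have -> : (n + 2 * m + 1 <= n + 2 * m)%N = false by lia.
Qed.

Lemma reached_string d I X (s : rep_hom (string I) X) :
  (d <= n + 2 * m)%N -> I = depth_interval d ->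
  reached d (s (pv 0) (unit_vec I (pv 0) (base_pos d))).
Proof. by move=> dK IE; subst I; rewrite /reached dK; exists s. Qed.

(** The inclusion contributes nothing to the full composition, so what remains
    is the passage through [a_m], which factors along the longest path. *)
Lemma chain_deep : rad_pow (n + 2 * m) (hom_chain chain_hom 1 n).
Proof.
apply: rad_comp_rad_pow; apply: rad_comp_twist.
- by rewrite /chain_interval /depth_interval /right_seq.
- rewrite /chain_interval /depth_interval /left_seq.
  by do ?[case: ifP => ?]; congr (_, _); lia.
move=> v t q vq; rewrite chain_entry_from1 //; last by lia.
rewrite [X in X + _]entry_out ?add0r //.
move: vq; rewrite /at_vertex /in_interval /chain_interval.
by do ?[case: ifP => ?]; rewrite /=; lia.
Qed.

Lemma at_last I : (I.1 <= N.-1)%N -> I.2 = N.-1 -> at_vertex I (pv 0) N.-1.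
Proof.
move=> I1 I2; rewrite (at_vertexE _ _ (pos_vertex_last hm hn)); last by lia.
by rewrite /in_interval I1 I2 leqnn.
Qed.

Lemma chain_last l : (1 < l <= n.+1)%N -> (chain_interval l).2 = N.-1.
Proof. by rewrite /chain_interval => ln; do ?[case: ifP => ?]; rewrite /=; lia. Qed.

Lemma chain_at_last l : (1 < l <= n.+1)%N -> at_vertex (chain_interval l) (pv 0) N.-1.
Proof.
move=> ln; apply: at_last; last exact: chain_last.
by rewrite /chain_interval; do ?[case: ifP => ?]; rewrite /=; lia.
Qed.

(** The filtration at [a_m] vanishes after [n + 2 m + 1] steps, but the
    composition does not kill the base vector of the first string. *)
Lemma chain_not_deeper : ~ rad_pow (n + 2 * m + 1) (hom_chain chain_hom 1 n).
Proof.
move=> deep.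
have e_in : @reached 0 (chain_rep 1) (unit_vec (chain_interval 1) (pv 0) 0).
  have := @reached_string 0 (chain_interval 1) _ (hom_id (chain_rep 1)).
  by rewrite id_lfunE; apply.
have zero := rad_pow_reached _ _ deep e_in.
have lastE : at_vertex (chain_interval (n + 1)) (pv 0) N.-1 by apply: chain_at_last; lia.
have := @chain_entry_from1 n (pv 0) (unit_vec (chain_interval 1) (pv 0) 0) N.-1 _ lastE.
rewrite zero ?linear0 ?eqxx; try lia.
rewrite !entry_unit (_ : (N.-1 == 0)%N = false); last by lia.
rewrite andbF add0r eqxx andbT at_vertex_pos //; try lia.
by move=> /(_ _)/eqP; rewrite eq_sym oner_eq0 => H; apply: notF; apply: H; lia.
Qed.

(** The second basis vector of [[0, N - 1]] over [a_m] starts at step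
    [2 m + 1] of the filtration, which leaves only [n - 1] shifts before the end. *)
Lemma chain_tail_shallow : ~ rad_pow n (hom_chain chain_hom 2 n.-1).
Proof.
move=> deep.
have e_in : @reached (2 * m).+1 (chain_rep 2) (unit_vec (chain_interval 2) (pv 0) N.-1).
  have bE : base_pos (2 * m).+1 = N.-1 by rewrite /base_pos ifF //; lia.
  have := @reached_string (2 * m).+1 (chain_interval 2) _ (hom_id (chain_rep 2)).
  rewrite id_lfunE bE; apply; first by lia.
  rewrite /chain_interval /depth_interval /left_seq.
  by do ?[case: ifP => ?]; rewrite //=; lia.
have zero := rad_pow_reached _ _ deep e_in.
have lastE : at_vertex (chain_interval (n.-1 + 2)) (pv 0) N.-1 by apply: chain_at_last; lia.
have := @chain_entry_from2 n.-1 (pv 0) (unit_vec (chain_interval 2) (pv 0) N.-1) N.-1 _ lastE.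
rewrite zero ?linear0; try lia.
rewrite entry_unit eqxx andbT chain_at_last; last by lia.
by move=> /(_ _)/eqP; rewrite eq_sym oner_eq0 => H; apply: notF; apply: H; lia.
Qed.

(** The projections kill the basis vector at position 0, so that in general the
    filtration at [a_m] only sees the deep perturbation of this composition. The
    basis vector at position [n - 1] is fixed by the inclusion and by these
    projections. *)
Lemma chain_init_shallow : ~ rad_pow n (hom_chain chain_hom 1 n.-1).
Proof.
move=> [r [g [rg fE]]]; set e := unit_vec (chain_interval 1) (pv n.-1) n.-1.
have e_in : e \in grid 1 (chain_rep 1) by apply: grid_start; lia.
have ge_in j : g j (pv n.-1) e \in grid_right_coend (chain_rep (n.-1 + 1)).
  apply: grid_final => //.
  pose D d M (x : M (pv n.-1)) := (0 < d)%N /\ x \in grid d M.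
  have shift d X Y (f : rep_hom X Y) x : (d < n.+1)%N -> radical f ->
      D d X x -> D d.+1 Y (f (pv n.-1) x).
    by move=> _ radf [d0 xd]; split=> //; apply: grid_shift.
  have [] // := rad_comp_shift shift _ _ (rg j) (conj (ltnSn 0) e_in); lia.
have fe_in : hom_chain chain_hom 1 n.-1 (pv n.-1) e \in grid_right_coend (chain_rep (n.-1 + 1)).
  by rewrite fE sum_lfunE; apply: memv_suml => i _; apply: ge_in.
have at_e : at_vertex (chain_interval (n.-1 + 1)) (pv n.-1) n.-1.
  apply: at_vertex_pos; first by lia.
  by rewrite /in_interval /chain_interval; do ?[case: ifP => ?]; rewrite /=; lia.
have := @grid_right_coend_string (chain_interval (n.-1 + 1)) _ _ _ fe_in.
rewrite chain_entry_from1 ?entry_unit //; last by lia.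
have -> : (n.-1 == N.-1) = false by lia.
have in1 : in_interval (chain_interval 1) n.-1 by rewrite /in_interval /= leqnn.
rewrite eqxx andbT at_vertex_pos //; last by lia.
have interval1 : ((chain_interval (n.-1 + 1)).1 <= n.-1)%N.
  by rewrite /chain_interval; do ?[case: ifP => ?]; rewrite /=; lia.
rewrite addr0 => /(_ interval1 _)/eqP; rewrite oner_eq0 => last1.
by apply: notF; apply: last1; apply: chain_last; lia.
Qed.

End StringModules.

Local Close Scope ring_scope.

Theorem theorem5p7 (k : fieldType) (m n : nat) (hm : (2 <= m)%N) (hn : (2 <= n)%N) :
  exists (X : nat -> rep k (U_bound m n.-1))
         (h : forall i : nat, rep_hom (X i) (X i.+1)),
    (forall i : nat, (1 <= i <= n.+1)%N -> indecomposable (X i)) /\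
    (forall i : nat, (1 <= i <= n)%N -> irreducible (h i)) /\
    rad_pow (n + 2 * m) (hom_chain h 1 n) /\
    ~ rad_pow (n + 2 * m + 1) (hom_chain h 1 n) /\
    ~ rad_pow n (hom_chain h 1 n.-1) /\
    ~ rad_pow n (hom_chain h 2 n.-1).
Proof.
exists (chain_rep k hm hn), (chain_hom k hm hn).
split; first by move=> i iN; apply: chain_indecomposable; lia.
split; last first.
  split; first exact: chain_deep.
  split; first exact: chain_not_deeper.
  by split; [apply: chain_init_shallow | apply: chain_tail_shallow].
move=> i iN; apply: radical_irreducible.
- by apply: chain_indecomposable; lia.
- by apply: chain_indecomposable; lia.
- exact: chain_radical.
(* a factor of depth two would make one of the two shorter compositions too deep *)
have nE : n = n.-1.+1 by lia.
move=> rad2; have [i1|i1] := leqP i n.-1.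
  apply: (@chain_init_shallow k m n hm hn); apply: rad_comp_rad_pow.
  rewrite [X in rad_comp X]nE; apply: (rad_comp_of_factor (j := i)) => //; first by lia.
  by move=> j jN; apply: chain_radical; lia.
apply: (@chain_tail_shallow k m n hm hn); apply: rad_comp_rad_pow.
rewrite [X in rad_comp X]nE; apply: (rad_comp_of_factor (j := i)) => //; first by lia.
by move=> j jN; apply: chain_radical; lia.
Qed.
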